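(* Let $k\ge1$. There is a surjective $\mathbb{C}$-algebra homomorphism $\mathsf{pr}:\mathcal{A}_{2k}^{\mathrm{aff}}\to\mathcal{A}_{2k}$ from the affine partition algebra to the partition algebra given on the generators by $$\mathsf{pr}(\tau_i)=t_i,\qquad \mathsf{pr}(e_i)=e_i,\qquad \mathsf{pr}(x_i)=X_i,\qquad \mathsf{pr}(z_l)=z(z-1)^l.$$
   Context: $[m]=\{1,\dots,m\}$. **Partition algebra.** $\mathcal{A}_{2k}$ is the $\mathbb{C}[z]$-algebra with $\mathbb{C}[z]$-basis the set partitions of $\{1,\dots,k\}\cup\{1',\dots,k'\}$ (drawn as diagrams with top row $1,\dots,k$ and bottom row $1',\dots,k'$), regarded as a $\mathbb{C}$-algebra; the product is $\alpha\beta=z^{m(\alpha,\beta)}\alpha\circ\beta$, where $\alpha\circ\beta$ is obtained by stacking $\alpha$ on top of $\beta$, identifying the bottom row of $\alpha$ with the top row of $\beta$, deleting the $m(\alpha,\beta)$ components lying entirely in the middle row and reading off the induced partition. $s_i$ ($i\in[k-1]$) has blocks $\{i,(i+1)'\},\{i+1,i'\}$ and $\{j,j'\}$ otherwise; $e_{2j-1}$ ($j\in[k]$) has blocks $\{j\},\{j'\}$ and $\{r,r'\}$ otherwise; $e_{2i}$ ($i\in[k-1]$) has block $\{i,i+1,i',(i+1)'\}$ and $\{r,r'\}$ otherwise. Elements $L_i$, $\sigma_i$ are defined recursively by $L_1=0$, $L_2=e_1$, $\sigma_2=1$, $\sigma_3=s_1$; for $i\ge1$ $L_{2i+2}=s_iL_{2i}s_i-s_iL_{2i}e_{2i}-e_{2i}L_{2i}s_i+e_{2i}L_{2i}e_{2i+1}e_{2i}+\sigma_{2i+1}$,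 $L_{2i+1}=s_iL_{2i-1}s_i-L_{2i}e_{2i}-e_{2i}L_{2i}+(z-L_{2i-1})e_{2i}+\sigma_{2i}$; and for $i\ge2$ $\sigma_{2i+1}=s_{i-1}s_i\sigma_{2i-1}s_is_{i-1}+s_ie_{2i-2}L_{2i-2}s_ie_{2i-2}s_i+e_{2i-2}L_{2i-2}s_ie_{2i-2}-s_ie_{2i-2}L_{2i-2}s_{i-1}e_{2i}e_{2i-1}e_{2i-2}-e_{2i-2}e_{2i-1}e_{2i}s_{i-1}L_{2i-2}e_{2i-2}s_i$, $\sigma_{2i}=s_{i-1}s_i\sigma_{2i-2}s_is_{i-1}+e_{2i-2}L_{2i-2}s_ie_{2i-2}s_i+s_ie_{2i-2}L_{2i-2}s_ie_{2i-2}-e_{2i-2}L_{2i-2}s_{i-1}e_{2i}e_{2i-1}e_{2i-2}-s_ie_{2i-2}e_{2i-1}e_{2i}s_{i-1}L_{2i-2}e_{2i-2}s_i$. Then $t_{2i}:=\sigma_{2i}-e_{2i}$, $t_{2i+1}:=\sigma_{2i+1}-e_{2i}$ ($i\in[k-1]$), and $X_i:=z-1-L_i$ for $i$ odd, $X_i:=L_i-1$ for $i$ even ($i\in[2k]$). **Affine partition algebra.** $\mathcal{A}_{2k}^{\mathrm{aff}}$ is the unital associative $\mathbb{C}$-algebra with generators $\tau_i$ ($2\le i\le 2k-1$), $e_j$ ($1\le j\le 2k-1$), $x_r$ ($1\le r\le 2k$), $z_l$ ($l\in\mathbb{Z}_{\ge0}$) and the following relations (where no range is given, for all indices for which all generators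 involved are defined): (1) $\tau_{2i}^2=1-e_{2i}$, $\tau_{2i+1}^2=1-e_{2i}$ for $i\in[k-1]$. (2) $\tau_{2i+1}\tau_{2j}=\tau_{2j}\tau_{2i+1}$ for $j\ne i+1$; $\tau_{2i+1}\tau_{2j+1}=\tau_{2j+1}\tau_{2i+1}$ and $\tau_{2i}\tau_{2j}=\tau_{2j}\tau_{2i}$ for $j\ne i\pm1$; $s_is_{i+1}s_i=s_{i+1}s_is_{i+1}$ for $i\in[k-2]$, where $s_j:=\tau_{2j}\tau_{2j+1}+e_{2j}$. (3) $e_{2i-1}^2=z_0e_{2i-1}$ ($i\in[k]$); and for $i\in[k-1]$: $e_{2i}^2=e_{2i}$, $\tau_{2i+1}e_{2i}=e_{2i}\tau_{2i+1}=0$, $\tau_{2i}e_{2i}=e_{2i}\tau_{2i}=0$, $\tau_{2i}e_{2i-1}e_{2i+1}=\tau_{2i+1}e_{2i-1}e_{2i+1}$, $e_{2i+1}e_{2i-1}\tau_{2i}=e_{2i+1}e_{2i-1}\tau_{2i+1}$. (4) $e_ie_j=e_je_i$ if $|i-j|\ge2$; $\tau_{2i-1}e_{2j-1}=e_{2j-1}\tau_{2i-1}$ if $j\ne i-1,i$; $\tau_{2i-1}e_{2j}=e_{2j}\tau_{2i-1}$ if $j\ne i$; $\tau_{2i}e_{2j-1}=e_{2j-1}\tau_{2i}$ if $j\neq i,i+1$; $\tau_{2i}e_{2j}=e_{2j}\tau_{2i}$ if $j\ne i-1$. (5) $e_ie_{i+1}e_i=e_i$, $e_{i+1}e_ie_{i+1}=e_{i+1}$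 for $i\in[2k-2]$; $\tau_{2i}e_{2i-1}\tau_{2i}=\tau_{2i+1}e_{2i+1}\tau_{2i+1}$ for $i\in[k-1]$; $\tau_{2i}e_{2i-2}\tau_{2i}=\tau_{2i-1}e_{2i}\tau_{2i-1}$ for $2\le i\le k-1$. (6) $x_ix_j=x_jx_i$; $\tau_ix_j=x_j\tau_i$ for $j\ne i-1,i,i+1$; $e_ix_j=x_je_i$ for $j\ne i,i+1$. (7) $\tau_{2i-2}\tau_{2i}\tau_{2i-2}=\tau_{2i}\tau_{2i-2}\tau_{2i}(1-e_{2i-2})$; $\tau_{2i+1}\tau_{2i-1}\tau_{2i+1}=\tau_{2i-1}\tau_{2i+1}\tau_{2i-1}(1-e_{2i})$; $\tau_{2i-1}\tau_{2i}\tau_{2i-1}=\tau_{2i}-e_{2i-2}\tau_{2i}-\tau_{2i}e_{2i-2}$; $\tau_{2i}\tau_{2i-1}\tau_{2i}=\tau_{2i-1}-e_{2i}\tau_{2i-1}-\tau_{2i-1}e_{2i}$. (8) $x_{2i+1}=\tau_{2i}x_{2i-1}\tau_{2i}+e_{2i}e_{2i-1}\tau_{2i}+\tau_{2i}e_{2i-1}e_{2i}-\tau_{2i}$; $x_{2i+2}=\tau_{2i+1}x_{2i}\tau_{2i+1}+e_{2i}e_{2i+1}\tau_{2i+1}e_{2i+1}e_{2i}+\tau_{2i+1}$; $x_{2i}=\tau_{2i}x_{2i}\tau_{2i}+e_{2i}e_{2i-1}\tau_{2i}+\tau_{2i}e_{2i-1}e_{2i}$; $x_{2i+1}=\tau_{2i+1}x_{2i+1}\tau_{2i+1}+e_{2i}e_{2i+1}\tau_{2i+1}+\tau_{2i+1}e_{2i+1}e_{2i}$.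 (9) $e_i(x_i-x_{i+1})=0=(x_i-x_{i+1})e_i$ for $i\in[2k-1]$. (10) $e_1x_1^le_1=z_le_1$ for $l\ge1$; every $z_l$ ($l\ge0$) is central. *)

(* Defs.v *)
From HB Require Import structures.
From mathcomp Require Import all_boot all_order all_algebra.
From mathcomp Require Import boolp monalg ring zify.

Set Implicit Arguments.
Unset Strict Implicit.
Unset Printing Implicit Defensive.

Import GRing.Theory.

Local Open Scope ring_scope.

(* [inl a] and [inr a] are the vertices labelled a+1 in the top row and (a+1)'
   in the bottom row. *)
Definition vertex (k : nat) : finType := ('I_k + 'I_k)%type.

Definition diagram (k : nat) : finType :=
  {P : {set {set vertex k}} | partition P [set: vertex k]}.

Definition same_block k (d : diagram k) : rel (vertex k) :=
  [rel u v | v \in pblock (val d) u].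

Definition fibres k (T : eqType) (f : vertex k -> T) : diagram k :=
  Sub (preim_partition f [set: vertex k]) (preim_partitionP f [set: vertex k]).

Lemma scaled_product_assoc (T : finType) (A B C AB BC A_BC AB_C : T -> T -> nat)
    (n1 n2 n3 n4 : nat) :
    (forall x z, \sum_y A x y * B y z = n1 * AB x z)%N ->
    (forall x z, \sum_y AB x y * C y z = n2 * AB_C x z)%N ->
    (forall x z, \sum_y B x y * C y z = n3 * BC x z)%N ->
    (forall x z, \sum_y A x y * BC y z = n4 * A_BC x z)%N ->
  forall x z, (n1 * n2 * AB_C x z = n3 * n4 * A_BC x z)%N.
Proof.
move=> h1 h2 h3 h4 x z; rewrite -!mulnA -h2 -h4 !big_distrr /=.
transitivity (\sum_y \sum_t A x t * B t y * C y z)%N.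
  by apply: eq_bigr => y _; rewrite mulnA -h1 big_distrl.
rewrite exchange_big; apply: eq_bigr => t _.
under eq_bigr do rewrite -mulnA.
by rewrite -big_distrr /= h3 mulnCA.
Qed.

(* [upper_vertex], [lower_vertex] and [outer_vertex] embed the vertices of a
   diagram into a stack: as those of the upper diagram, of the lower diagram
   and of the resulting diagram.  [stack_conn], [loops] and other constants
   below are locked because unfolding them makes unification diverge. *)
Section StackingDefs.

Variable k : nat.
Implicit Types (a b c d : diagram k) (u v : vertex k).

(* The three rows of a stack of two diagrams: [inl (inl i)] is on top,
   [inl (inr i)] in the middle and [inr i] at the bottom. *)
Definition stack_vertex : finType := ('I_k + 'I_k + 'I_k)%type.
Implicit Types w : stack_vertex.

Definition upper_vertex u : stack_vertex := inl u.

Definition lower_vertex u : stack_vertex :=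
  match u with inl i => inl (inr i) | inr i => inr i end.

Definition outer_vertex u : stack_vertex :=
  match u with inl i => inl (inl i) | inr i => inr i end.

Definition middle_vertex (i : 'I_k) : stack_vertex := inl (inr i).

Definition stack_edge a b : rel stack_vertex := [rel w w' |
     [exists u, exists v,
        [&& same_block a u v, w == upper_vertex u & w' == upper_vertex v]]
  || [exists u, exists v,
        [&& same_block b u v, w == lower_vertex u & w' == lower_vertex v]]].

End StackingDefs.

Arguments upper_vertex {k} u.
Arguments lower_vertex {k} u.
Arguments outer_vertex {k} u.
Arguments middle_vertex {k} i.

HB.lock Definition stack_conn k (a b : diagram k) : rel (stack_vertex k) :=
  connect (stack_edge a b).

Definition components k (a b : diagram k) : {set {set stack_vertex k}} :=
  equivalence_partition (stack_conn a b) [set: stack_vertex k].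

HB.lock Definition loops k (a b : diagram k) : nat :=
  #|[set B in components a b | B \subset [set middle_vertex i | i : 'I_k]]|.

Section Stacking.

Variable k : nat.
Implicit Types (a b c d : diagram k) (u v : vertex k).
Local Notation stack_vertex := (stack_vertex k).
Implicit Types w : stack_vertex.

Lemma partition_same_block d : equivalence_rel (same_block d).
Proof.
have/and3P[/eqP cP tP _] := valP d.
move=> u v w; rewrite /same_block /= mem_pblock cP inE; split=> // uv.
by rewrite (same_pblock tP uv).
Qed.

Lemma same_block_refl d u : same_block d u u.
Proof. by have [] := partition_same_block d u u u. Qed.

Lemma same_block_sym d : symmetric (same_block d).
Proof.
have E := partition_same_block d.
have imp u v : same_block d u v -> same_block d v u.
  by move=> uv; have [_ /(_ uv)] := E u v u; rewrite same_block_refl => <-.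
by move=> u v; apply/idP/idP; apply: imp.
Qed.

Lemma stack_edge_sym a b : symmetric (stack_edge a b).
Proof.
have imp w w' : stack_edge a b w w' -> stack_edge a b w' w.
  by case/orP=> /existsP[u /existsP[v /and3P[uv wu wv]]]; apply/orP; [left|right];
    apply/existsP; exists v; apply/existsP; exists u; rewrite same_block_sym uv wv.
by move=> w w'; apply/idP/idP; apply: imp.
Qed.

Lemma stack_conn_sym a b : symmetric (stack_conn a b).
Proof.
by rewrite stack_conn.unlock; exact: sym_connect_sym (stack_edge_sym a b).
Qed.

Lemma stack_conn0 a b w : stack_conn a b w w.
Proof. by rewrite stack_conn.unlock; apply: connect0. Qed.

Lemma stack_conn1 a b w w' : stack_edge a b w w' -> stack_conn a b w w'.
Proof. by rewrite stack_conn.unlock; apply: connect1. Qed.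

Lemma stack_conn_same_r a b w0 w w' : stack_conn a b w w' ->
  stack_conn a b w0 w = stack_conn a b w0 w'.
Proof.
rewrite stack_conn.unlock => ww'.
exact: (same_connect_r (sym_connect_sym (stack_edge_sym a b))).
Qed.

Lemma stack_conn_equiv a b : equivalence_rel (stack_conn a b).
Proof.
apply/equivalence_relP; split; first by move=> w; apply: stack_conn0.
move=> w w' ww' w0; rewrite ![stack_conn a b _ w0]stack_conn_sym.
exact: stack_conn_same_r.
Qed.

Lemma outer_conn_equiv a b :
  {in [set: vertex k] & &,
   equivalence_rel (relpre outer_vertex (stack_conn a b))}.
Proof. by move=> u v w _ _ _; apply: stack_conn_equiv. Qed.

Definition comp a b : diagram k :=
  Sub (equivalence_partition (relpre outer_vertex (stack_conn a b))
         [set: vertex k])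
      (equivalence_partitionP (outer_conn_equiv a b)).

Definition id_diagram : diagram k :=
  fibres (fun v => match v with inl i => i | inr i => i end).

Lemma same_block_fibres (T : eqType) (f : vertex k -> T) u v :
  same_block (fibres f) u v = (f u == f v).
Proof.
rewrite /same_block /= pblock_equivalence_partition ?inE //.
by move=> ? ? ? _ _ _; split=> [|/eqP->].
Qed.

Lemma same_block_comp a b u v :
  same_block (comp a b) u v = stack_conn a b (outer_vertex u) (outer_vertex v).
Proof.
by rewrite /same_block /= (pblock_equivalence_partition (outer_conn_equiv a b)).
Qed.

Lemma same_block_inj d d' : same_block d =2 same_block d' -> d = d'.
Proof.
move=> E; apply: val_inj.
have eqd (c : diagram k) :
    val c = equivalence_partition (same_block c) [set: vertex k].
  have/and3P[/eqP cP tP nP] := valP c.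
  rewrite -{1}(equivalence_partition_pblock (valP c)) //.
rewrite (eqd d) (eqd d'); apply: eq_imset => u.
by apply/setP=> v; rewrite !inE E.
Qed.

(* Two-colourings of the rows that are constant on blocks.  Counting them turns
   stacking into a matrix product, which gives associativity. *)
Local Notation row := {ffun 'I_k -> bool}.
Implicit Types x y z : row.

Definition colour x y (v : vertex k) : bool :=
  match v with inl i => x i | inr i => y i end.

Definition compatible d x y : bool :=
  [forall u, forall v, same_block d u v ==> (colour x y u == colour x y v)].

Definition stack_colour x y z (w : stack_vertex) : bool :=
  match w with inl v => colour x y v | inr i => z i end.

Lemma compatibleP d x y :
  reflect (forall u v, same_block d u v -> colour x y u = colour x y v)
          (compatible d x y).
Proof.
apply: (iffP forallP) => [h u v uv | h u].
  by have /forallP/(_ v)/implyP/(_ uv)/eqP := h u.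
by apply/forallP=> v; apply/implyP=> /h ->.
Qed.

Lemma compatible_stackP a b x y z :
  reflect (forall w w', stack_conn a b w w' ->
             stack_colour x y z w = stack_colour x y z w')
          (compatible a x y && compatible b y z).
Proof.
have lowE u : stack_colour x y z (lower_vertex u) = colour y z u by case: u.
apply: (iffP andP) => [[/compatibleP ha /compatibleP hb] w w'| h].
  rewrite stack_conn.unlock; case/connectP=> p; elim: p w => [|w1 p IH] w /=; first by move=> _ ->.
  case/andP=> e pp lw; rewrite -(IH _ pp lw).
  case/orP: e => /existsP[u /existsP[v /and3P[uv /eqP-> /eqP->]]].
    exact: ha.
  by rewrite !lowE; exact: hb.
split; apply/compatibleP=> u v uv.
  apply: (h (inl u) (inl v)); apply/stack_conn1/orP; left.
  by apply/existsP; exists u; apply/existsP; exists v; rewrite uv !eqxx.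
rewrite -!lowE; apply/h/stack_conn1/orP; right.
by apply/existsP; exists u; apply/existsP; exists v; rewrite uv !eqxx.
Qed.

Lemma card_compatible_stack a b x z :
  #|[set y | compatible a x y && compatible b y z]|
    = (2 ^ loops a b * compatible (comp a b) x z)%N.
Proof.
have outE y u : stack_colour x y z (outer_vertex u) = colour x z u by case: u.
case: (boolP (compatible (comp a b) x z)) => [/compatibleP cxz | ncxz]; last first.
  rewrite muln0; apply/eqP; rewrite cards_eq0; apply/eqP/setP=> y.
  rewrite !inE; apply/negbTE; apply: contra ncxz => /compatible_stackP h.
  by apply/compatibleP=> u v; rewrite same_block_comp -2!(outE y) => /h.
rewrite muln1 loops.unlock; set M := [set B in _ | _]; rewrite -card_powerset.
pose E := stack_conn a b.
have eqE : {in [set: stack_vertex] & &, equivalence_rel E}.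
  by move=> ? ? ? _ _ _; apply: stack_conn_equiv.
pose cl w := pblock (components a b) w.
have clE w w' : (w' \in cl w) = E w w' by rewrite pblock_equivalence_partition.
have cpart : partition (components a b) [set: stack_vertex].
  exact: equivalence_partitionP.
have/and3P[/eqP cP tP nP] := cpart.
have cl_mem w : cl w \in components a b by apply: pblock_mem; rewrite cP inE.
have cl_eq w w' : E w w' -> cl w = cl w'.
  by move=> ww'; apply/esym/same_pblock => //; rewrite -/(cl w) clE.
pose gen (S : {set {set stack_vertex}}) w :=
  if [pick v | E (outer_vertex v) w] is Some v then colour x z v else cl w \in S.
pose g S : row := [ffun i => gen S (middle_vertex i)].
have genE S w : stack_colour x (g S) z w = gen S w.
  have outg u : colour x z u = gen S (outer_vertex u).
    rewrite /gen; case: pickP => [v | /(_ u)]; last by rewrite /E stack_conn0.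
    by rewrite /E -same_block_comp => /cxz.
  case: w => [[i|i]|i] /=; last exact: (outg (inr i)).
    exact: (outg (inl i)).
  by rewrite ffunE.
have nopick i : cl (middle_vertex i) \subset [set middle_vertex i | i : 'I_k] ->
    [pick v | E (outer_vertex v) (middle_vertex i)] = None.
  move=> /subsetP sub; case: pickP => // v; rewrite /E stack_conn_sym -/E -clE.
  by move/sub => /imsetP[j _]; case: v.
have -> : [set y | compatible a x y && compatible b y z] = g @: powerset M.
  apply/setP=> y; rewrite !inE; apply/compatible_stackP/imsetP => [h | [S _ ->]].
    exists [set B in M | [exists i, (middle_vertex i \in B) && y i]].
      by rewrite powersetE; apply/subsetP=> B; rewrite inE => /andP[].
    apply/ffunP=> i; rewrite ffunE /gen; case: pickP => [v /h|no].
      by rewrite outE.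
    have -> : cl (middle_vertex i) \in [set B in M | [exists i, (middle_vertex i \in B) && y i]]
        = [exists j, (middle_vertex j \in cl (middle_vertex i)) && y j].
      rewrite !inE cl_mem /=; apply/andb_idl=> _.
      apply/subsetP=> w; rewrite clE => iw; apply/imsetP.
      have no' v : w != outer_vertex v.
        apply/eqP=> wv; have:= no v; rewrite /E stack_conn_sym -/E -wv.
        by rewrite iw.
      case: w iw no' => [[j|j]|j] _ no'; last by have:= no' (inr j); rewrite eqxx.
        by have:= no' (inl j); rewrite eqxx.
      by exists j.
    apply/idP/existsP => [yi | [j /andP[]]].
      by exists i; rewrite clE /E stack_conn0.
    by rewrite clE => /h /= ->.
  move=> w w' ww'; rewrite !genE /gen (cl_eq _ _ ww').
  have -> // : [pick v | E (outer_vertex v) w] = [pick v | E (outer_vertex v) w'].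
  by apply: eq_pick => v; apply: stack_conn_same_r.
rewrite card_in_imset // => S T; rewrite !powersetE => /subsetP SM /subsetP TM gST.
have key (U : {set {set stack_vertex}}) B : B \in M ->
    forall i, middle_vertex i \in B -> g U i = (B \in U).
  rewrite inE => /andP[Bc Bm] i iB; have clB : cl (middle_vertex i) = B.
    exact: def_pblock.
  by rewrite ffunE /gen nopick clB.
have nonempty B : B \in M -> exists i, middle_vertex i \in B.
  rewrite inE => /andP[Bc /subsetP Bm].
  have /set0Pn[w wB] : B != set0 by apply: contraNneq nP => <-.
  by have /imsetP[i _ wi] := Bm _ wB; exists i; rewrite -wi.
apply/setP=> B; apply/idP/idP => [BS | BT].
  have BM := SM _ BS; have [i iB] := nonempty B BM.
  by rewrite -(key T B BM i iB) -gST (key S B BM i iB).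
have BM := TM _ BT; have [i iB] := nonempty B BM.
by rewrite -(key S B BM i iB) gST (key T B BM i iB).
Qed.

Lemma compatible_stack_sum a b x z :
  (\sum_y compatible a x y * compatible b y z
    = 2 ^ loops a b * compatible (comp a b) x z)%N.
Proof.
rewrite -card_compatible_stack -sum1_card [RHS]big_mkcond /=.
by apply: eq_bigr => y _; rewrite inE mulnb; case: (_ && _).
Qed.

Lemma compatible_const d : compatible d [ffun=> true] [ffun=> true].
Proof. by apply/compatibleP=> -[u|u] [v|v] _; rewrite /= !ffunE. Qed.

Lemma compatible_inj m m' d d' :
    (forall x y, 2 ^ m * compatible d x y = 2 ^ m' * compatible d' x y)%N ->
  m = m' /\ d = d'.
Proof.
move=> h; have /eqP := h [ffun=> true] [ffun=> true].
rewrite !compatible_const !muln1 eqn_exp2l // => /eqP mm'; split=> //.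
have{}h x y : compatible d x y = compatible d' x y.
  have /eqP := h x y; rewrite mm' eqn_pmul2l ?expn_gt0 //.
  by do 2!case: (compatible _ _ _).
suff imp (c c' : diagram k) : (forall x y, compatible c x y = compatible c' x y) ->
    forall u v, same_block c' u v -> same_block c u v.
  by apply: same_block_inj => u v; apply/idP/idP; apply: imp.
move=> {}h u v; pose x := [ffun i => same_block c u (inl i)].
pose y := [ffun i => same_block c u (inr i)].
have colE t : colour x y t = same_block c u t by case: t => i /=; rewrite ffunE.
have /compatibleP hc' : compatible c' x y.
  rewrite -h; apply/compatibleP=> t t' tt'; rewrite !colE.
  have Ec := partition_same_block c.
  apply/idP/idP=> [ut | ut']; first by have [_ /(_ ut) ->] := Ec u t t'.
  by have [_ /(_ ut') ->] := Ec u t' t; rewrite same_block_sym.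
by move=> /hc'; rewrite !colE same_block_refl.
Qed.

Lemma comp_loopsA a b c :
  (loops a b + loops (comp a b) c = loops b c + loops a (comp b c))%N
  /\ comp (comp a b) c = comp a (comp b c).
Proof.
apply: compatible_inj => x z.
have := scaled_product_assoc (compatible_stack_sum a b)
  (compatible_stack_sum (comp a b) c) (compatible_stack_sum b c)
  (compatible_stack_sum a (comp b c)) x z.
move: (loops a b) => n1; move: (loops _ _) => n2.
move: (loops b c) => n3; move: (loops _ _) => n4.
by rewrite -!expnD.
Qed.

Lemma compatible_id x y : compatible id_diagram x y = (x == y).
Proof.
apply/compatibleP/eqP => [h | -> [i|i] [j|j]]; last 4 first.
- by rewrite same_block_fibres => /eqP ->.
- by rewrite same_block_fibres => /eqP ->.
- by rewrite same_block_fibres => /eqP ->.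
- by rewrite same_block_fibres => /eqP ->.
by apply/ffunP=> i; apply: (h (inl i) (inr i)); rewrite same_block_fibres.
Qed.

Lemma comp_loops1 a : loops id_diagram a = 0%N /\ comp id_diagram a = a.
Proof.
apply: compatible_inj => x z; rewrite -(compatible_stack_sum _ _ x z) mul1n (bigD1 x) //=.
rewrite compatible_id eqxx mul1n big1 ?addn0 // => y /negbTE yx.
by rewrite compatible_id eq_sym yx.
Qed.

Lemma comp_loopsr1 a : loops a id_diagram = 0%N /\ comp a id_diagram = a.
Proof.
apply: compatible_inj => x z; rewrite -(compatible_stack_sum _ _ x z) mul1n (bigD1 z) //=.
rewrite compatible_id eqxx muln1 big1 ?addn0 // => y /negbTE yz.
by rewrite compatible_id yz muln0.
Qed.

End Stacking.

(* The free F[z]-module on the diagrams; z is the variable ['X] of [{poly F}]. *)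
Definition partition_algebra (F : comNzRingType) (k : nat) : Type :=
  {ffun diagram k -> {poly F}}.

HB.instance Definition _ (F : comNzRingType) k :=
  GRing.Lmodule.copy (partition_algebra F k) {ffun diagram k -> {poly F}}.

HB.lock Definition pa_diagram (F : comNzRingType) k (d : diagram k) :
  partition_algebra F k := [ffun d' => (d' == d)%:R].
Arguments pa_diagram F {k} d.

HB.lock Definition pa_z (F : comNzRingType) k : partition_algebra F k :=
  [ffun d => if d == id_diagram k then 'X else 0].

HB.lock Definition pa_mul (F : comNzRingType) k (f g : partition_algebra F k) :
  partition_algebra F k :=
  [ffun d => \sum_a \sum_(b | comp a b == d) 'X^(loops a b) * (f a * g b)].
Arguments pa_mul {F k} f g.

Section PartitionAlgebra.

Variables (F : comNzRingType) (k : nat).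
Local Notation PA := (partition_algebra F k).
Implicit Types f g h : PA.
Local Notation pa_diagram := (@pa_diagram F k).
Local Notation pa_z := (pa_z F k).
Local Notation pa_mul := (@pa_mul F k).

Lemma pa_diagramE d d' : pa_diagram d d' = (d' == d)%:R.
Proof. by rewrite pa_diagram.unlock ffunE. Qed.

Lemma pa_zE d : pa_z d = if d == id_diagram k then 'X else 0.
Proof. by rewrite pa_z.unlock ffunE. Qed.

Lemma pa_mulE f g d : pa_mul f g d =
  \sum_a \sum_(b | comp a b == d) 'X^(loops a b) * (f a * g b).
Proof. by rewrite pa_mul.unlock ffunE. Qed.

Definition pa_one : PA := pa_diagram (id_diagram k).

Lemma sum_pa_mul f g (G : diagram k -> {poly F}) :
  \sum_d pa_mul f g d * G d
    = \sum_a \sum_b 'X^(loops a b) * (f a * g b) * G (comp a b).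
Proof.
under eq_bigr => d _.
  rewrite pa_mulE mulr_suml.
  under eq_bigr => a _ do rewrite mulr_suml big_mkcond /=.
  over.
rewrite exchange_big; apply: eq_bigr => a _ /=.
rewrite exchange_big; apply: eq_bigr => b _ /=.
rewrite (bigD1 (comp a b)) //= eqxx big1 ?addr0 // => d /negbTE ne.
by rewrite eq_sym ne.
Qed.

Lemma pa_mulA : associative pa_mul.
Proof.
move=> f g h; apply/ffunP=> d; rewrite !pa_mulE; symmetry.
transitivity (\sum_e pa_mul f g e *
    \sum_(c | comp e c == d) 'X^(loops e c) * h c).
  apply: eq_bigr => e _; rewrite mulr_sumr; apply: eq_bigr => c _.
  by rewrite mulrCA.
rewrite sum_pa_mul; apply: eq_bigr => a _.
transitivity (\sum_e pa_mul g h e *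
    (if comp a e == d then 'X^(loops a e) * f a else 0)); last first.
  rewrite [RHS]big_mkcond; apply: eq_bigr => e _.
  by case: ifP => _; rewrite ?mulr0 // mulrC mulrA.
rewrite sum_pa_mul; apply: eq_bigr => b _; rewrite mulr_sumr big_mkcond /=.
apply: eq_bigr => c _; have [lA cA] := comp_loopsA a b c.
rewrite cA; case: ifP => _; last by rewrite !mulr0.
have : 'X^(loops a b) * 'X^(loops (comp a b) c)
    = 'X^(loops b c) * 'X^(loops a (comp b c)) :> {poly F} by rewrite -!exprD lA.
move: ('X^(loops a b)) ('X^(loops _ c)) ('X^(loops b c)) => p q r.
move: ('X^(loops a _)) => t E.
transitivity (p * q * (f a * g b * h c)); first by ring.
by rewrite E; ring.
Qed.

Lemma pa_mul1 : left_id pa_one pa_mul.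
Proof.
move=> f; apply/ffunP=> d; rewrite pa_mulE (bigD1 (id_diagram k)) //=.
rewrite [X in _ + X]big1 => [|a /negbTE ne]; last first.
  by apply: big1 => b _; rewrite pa_diagramE ne mul0r mulr0.
rewrite addr0 (big_pred1 d) => [|b]; last by rewrite (comp_loops1 b).2.
by rewrite (comp_loops1 d).1 pa_diagramE eqxx !mul1r.
Qed.

Lemma pa_mulr1 : right_id pa_one pa_mul.
Proof.
move=> f; apply/ffunP=> d; rewrite pa_mulE (bigD1 d) //=.
rewrite [X in _ + X]big1 => [|a ne]; last first.
  apply: big1 => b /eqP ab; rewrite pa_diagramE.
  case: (b =P id_diagram k) => [bid|_]; last by rewrite !mulr0.
  by rewrite -ab bid (comp_loopsr1 a).2 eqxx in ne.
rewrite addr0 (bigD1 (id_diagram k)) ?(comp_loopsr1 d).2 //=.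
rewrite (comp_loopsr1 d).1 pa_diagramE eqxx mul1r mulr1 big1 ?addr0 // => b.
by case/andP=> _ /negbTE ne; rewrite pa_diagramE ne !mulr0.
Qed.

Lemma pa_mulDl : left_distributive pa_mul +%R.
Proof.
move=> f g h; apply/ffunP=> d; rewrite ffunE !pa_mulE -big_split /=.
apply: eq_bigr => a _; rewrite -big_split /=.
by apply: eq_bigr => b _; rewrite ffunE mulrDl mulrDr.
Qed.

Lemma pa_mulDr : right_distributive pa_mul +%R.
Proof.
move=> f g h; apply/ffunP=> d; rewrite ffunE !pa_mulE -big_split /=.
apply: eq_bigr => a _; rewrite -big_split /=.
by apply: eq_bigr => b _; rewrite ffunE !mulrDr.
Qed.

Lemma pa_one_neq0 : pa_one != 0.
Proof.
by apply/eqP => /ffunP/(_ (id_diagram k))/eqP; rewrite pa_diagramE ffunE eqxx oner_eq0.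
Qed.

HB.instance Definition _ := GRing.Zmodule_isNzRing.Build PA
  pa_mulA pa_mul1 pa_mulr1 pa_mulDl pa_mulDr pa_one_neq0.

Lemma pa_scalerAl (c : F) f g : c *: (f * g) = c *: f * g.
Proof.
apply/ffunP=> d; rewrite ffunE !pa_mulE scaler_sumr; apply: eq_bigr => a _.
rewrite scaler_sumr; apply: eq_bigr => b _.
by rewrite ffunE -scalerAl -scalerAr.
Qed.

Lemma pa_scalerAr (c : F) f g : c *: (f * g) = f * (c *: g).
Proof.
apply/ffunP=> d; rewrite ffunE !pa_mulE scaler_sumr; apply: eq_bigr => a _.
rewrite scaler_sumr; apply: eq_bigr => b _.
by rewrite ffunE -!scalerAr.
Qed.

HB.instance Definition _ := GRing.Lmodule_isLalgebra.Build F PA pa_scalerAl.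
HB.instance Definition _ := GRing.Lalgebra_isAlgebra.Build F PA pa_scalerAr.

Lemma pa_zXM n f d : (pa_z ^+ n * f) d = 'X^n * f d.
Proof.
elim: n => [|n IH]; first by rewrite !expr0 !mul1r.
rewrite !exprS -!mulrA -IH; move: (pa_z ^+ n * f) => g.
rewrite pa_mulE (bigD1 (id_diagram k)) //= [X in _ + X]big1; last first.
  by move=> a /negbTE ne; apply: big1 => b _; rewrite pa_zE ne mul0r mulr0.
rewrite addr0 (big_pred1 d) => [|b]; last by rewrite (comp_loops1 b).2.
by rewrite (comp_loops1 d).1 pa_zE eqxx mul1r.
Qed.

Lemma pa_diagramM a b :
  pa_diagram a * pa_diagram b = pa_z ^+ loops a b * pa_diagram (comp a b).
Proof.
apply/ffunP=> d; rewrite pa_zXM pa_mulE (bigD1 a) //= [X in _ + X]big1.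
  rewrite addr0 big_mkcond (bigD1 b) //= [X in _ + X]big1.
    rewrite addr0 !pa_diagramE !eqxx !mulr1 eq_sym.
    by case: eqP; rewrite ?mulr1 ?mulr0.
  by move=> b' /negbTE ne; rewrite !pa_diagramE ne !mulr0 if_same.
by move=> a' /negbTE ne; apply: big1 => b' _; rewrite pa_diagramE ne mul0r mulr0.
Qed.

End PartitionAlgebra.

Section PartitionAlgebraElements.

Variables (F : comNzRingType) (k : nat).
Local Notation PA := (partition_algebra F k).

Definition position (v : vertex k) : nat :=
  match v with inl a => a.+1 | inr a => a.+1 end.

(* Each block is a fibre of the indicated labelling of the vertices. *)
Definition s_diagram (i : nat) : diagram k :=
  fibres (fun v => match v with
    | inl a => a.+1
    | inr a => if a.+1 == i then i.+1 else if a.+1 == i.+1 then i else a.+1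
    end).

Definition e_odd_diagram (j : nat) : diagram k :=
  fibres (fun v => match v with
    | inl a => if a.+1 == j then 0%N else a.+1
    | inr a => if a.+1 == j then k.+1 else a.+1
    end).

Definition e_even_diagram (i : nat) : diagram k :=
  fibres (fun v => if position v == i.+1 then i else position v).

(* Outside the index ranges of the theory, [pa_s], [pa_e] and the elements
   built from them have no meaning. *)
Definition pa_s (i : nat) : PA := pa_diagram F (s_diagram i).

Definition pa_e (n : nat) : PA :=
  pa_diagram F (if odd n then e_odd_diagram n.+1./2 else e_even_diagram n./2).

Local Notation s := pa_s.
Local Notation e := pa_e.
Local Notation z := (pa_z F k).

(* [L_odd i], [L_even i], [sigma_even i] and [sigma_odd i] are L_(2i-1), L_(2i),
   sigma_(2i) and sigma_(2i+1) for i >= 1; the value at i = 0 is unused. *)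
Fixpoint L_odd (i : nat) : PA :=
  match i with
  | 0 | 1 => 0
  | j.+1 => s j * L_odd j * s j - L_even j * e (2 * j) - e (2 * j) * L_even j
            + (z - L_odd j) * e (2 * j) + sigma_even j
  end
with L_even (i : nat) : PA :=
  match i with
  | 0 => 0
  | 1 => e 1
  | j.+1 => s j * L_even j * s j - s j * L_even j * e (2 * j)
            - e (2 * j) * L_even j * s j
            + e (2 * j) * L_even j * e (2 * j + 1) * e (2 * j) + sigma_odd j
  end
with sigma_even (i : nat) : PA :=
  match i with
  | 0 => 0
  | 1 => 1
  | j.+1 => let i := j.+1 in
      s (i - 1) * s i * sigma_even j * s i * s (i - 1)
      + e (2 * i - 2) * L_even j * s i * e (2 * i - 2) * s i
      + s i * e (2 * i - 2) * L_even j * s i * e (2 * i - 2)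
      - e (2 * i - 2) * L_even j * s (i - 1) * e (2 * i) * e (2 * i - 1)
        * e (2 * i - 2)
      - s i * e (2 * i - 2) * e (2 * i - 1) * e (2 * i) * s (i - 1) * L_even j
        * e (2 * i - 2) * s i
  end
with sigma_odd (i : nat) : PA :=
  match i with
  | 0 => 0
  | 1 => s 1
  | j.+1 => let i := j.+1 in
      s (i - 1) * s i * sigma_odd j * s i * s (i - 1)
      + s i * e (2 * i - 2) * L_even j * s i * e (2 * i - 2) * s i
      + e (2 * i - 2) * L_even j * s i * e (2 * i - 2)
      - s i * e (2 * i - 2) * L_even j * s (i - 1) * e (2 * i) * e (2 * i - 1)
        * e (2 * i - 2)
      - e (2 * i - 2) * e (2 * i - 1) * e (2 * i) * s (i - 1) * L_even j
        * e (2 * i - 2) * s i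
  end.

Definition pa_L (n : nat) : PA := if odd n then L_odd n.+1./2 else L_even n./2.

Definition pa_sigma (n : nat) : PA :=
  if odd n then sigma_odd n./2 else sigma_even n./2.

Definition pa_t (n : nat) : PA := pa_sigma n - e (2 * n./2).

Definition pa_X (n : nat) : PA := if odd n then z - 1 - pa_L n else pa_L n - 1.

Local Notation L := pa_L.
Local Notation sg := pa_sigma.

Lemma pa_L_double i : L (2 * i) = L_even i.
Proof. by rewrite /pa_L mul2n odd_double doubleK. Qed.

Lemma pa_L_double1 i : L (2 * i + 1) = L_odd i.+1.
Proof. by rewrite /pa_L addn1 mul2n /= odd_double /= doubleK. Qed.

Lemma pa_sigma_double i : sg (2 * i) = sigma_even i.
Proof. by rewrite /pa_sigma mul2n odd_double doubleK. Qed.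

Lemma pa_sigma_double1 i : sg (2 * i + 1) = sigma_odd i.
Proof.
by rewrite /pa_sigma addn1 mul2n /= odd_double /= uphalf_double.
Qed.

Lemma pa_L_evenE i : (1 <= i)%N ->
  L (2 * i + 2) = s i * L (2 * i) * s i - s i * L (2 * i) * e (2 * i)
    - e (2 * i) * L (2 * i) * s i
    + e (2 * i) * L (2 * i) * e (2 * i + 1) * e (2 * i) + sg (2 * i + 1).
Proof.
case: i => // i _; have -> : (2 * i.+1 + 2 = 2 * i.+2)%N by lia.
by rewrite !pa_L_double pa_sigma_double1.
Qed.

Lemma pa_L_oddE i : (1 <= i)%N ->
  L (2 * i + 1) = s i * L (2 * i - 1) * s i - L (2 * i) * e (2 * i)
    - e (2 * i) * L (2 * i) + (z - L (2 * i - 1)) * e (2 * i) + sg (2 * i).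
Proof.
case: i => // i _; have -> : (2 * i.+1 - 1 = 2 * i + 1)%N by lia.
by rewrite !pa_L_double1 pa_L_double pa_sigma_double.
Qed.

Lemma pa_sigma_oddE i : (2 <= i)%N ->
  sg (2 * i + 1) = s (i - 1) * s i * sg (2 * i - 1) * s i * s (i - 1)
    + s i * e (2 * i - 2) * L (2 * i - 2) * s i * e (2 * i - 2) * s i
    + e (2 * i - 2) * L (2 * i - 2) * s i * e (2 * i - 2)
    - s i * e (2 * i - 2) * L (2 * i - 2) * s (i - 1) * e (2 * i)
      * e (2 * i - 1) * e (2 * i - 2)
    - e (2 * i - 2) * e (2 * i - 1) * e (2 * i) * s (i - 1) * L (2 * i - 2)
      * e (2 * i - 2) * s i.
Proof.
case: i => // -[//|i] _.
have -> : (2 * i.+2 - 1 = 2 * i.+1 + 1)%N by lia.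
have -> : (2 * i.+2 - 2 = 2 * i.+1)%N by lia.
rewrite !pa_sigma_double1 pa_L_double /= -/(L_even _).
have -> : (2 * i.+2 - 1 = 2 * i.+1 + 1)%N by lia.
by have -> : (2 * i.+2 - 2 = 2 * i.+1)%N by lia.
Qed.

Lemma pa_sigma_evenE i : (2 <= i)%N ->
  sg (2 * i) = s (i - 1) * s i * sg (2 * i - 2) * s i * s (i - 1)
    + e (2 * i - 2) * L (2 * i - 2) * s i * e (2 * i - 2) * s i
    + s i * e (2 * i - 2) * L (2 * i - 2) * s i * e (2 * i - 2)
    - e (2 * i - 2) * L (2 * i - 2) * s (i - 1) * e (2 * i) * e (2 * i - 1)
      * e (2 * i - 2)
    - s i * e (2 * i - 2) * e (2 * i - 1) * e (2 * i) * s (i - 1)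
      * L (2 * i - 2) * e (2 * i - 2) * s i.
Proof.
case: i => // -[//|i] _.
have -> : (2 * i.+2 - 2 = 2 * i.+1)%N by lia.
rewrite !pa_sigma_double pa_L_double /=.
by have -> : (2 * i.+2 - 2 = 2 * i.+1)%N by lia.
Qed.

End PartitionAlgebraElements.

(* The two-sided ideal generated by the differences u - v with [rel u v]. *)
Inductive ideal_gen (A : nzRingType) (rel : A -> A -> Prop) : A -> Prop :=
  | ideal_gen_rel u v of rel u v : ideal_gen rel (u - v)
  | ideal_gen0 : ideal_gen rel 0
  | ideal_genB u v of ideal_gen rel u & ideal_gen rel v : ideal_gen rel (u - v)
  | ideal_genMl u v of ideal_gen rel v : ideal_gen rel (u * v)
  | ideal_genMr u v of ideal_gen rel u : ideal_gen rel (u * v).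

Section IdealQuotient.

Variables (F : comNzRingType) (A : algType F) (rel : A -> A -> Prop).

Definition ideal_pred : {pred A} := fun u => `[< ideal_gen rel u >].

Lemma ideal_predP u : reflect (ideal_gen rel u) (u \in ideal_pred).
Proof. exact: asboolP. Qed.

Lemma ideal_pred_zmod_closed : zmod_closed ideal_pred.
Proof.
split=> [|u v /ideal_predP uI /ideal_predP vI]; apply/ideal_predP.
  exact: ideal_gen0.
exact: ideal_genB.
Qed.

HB.instance Definition _ :=
  GRing.isZmodClosed.Build A ideal_pred ideal_pred_zmod_closed.

Definition quot_algebra : Type := Quotient.quot ideal_pred.

HB.instance Definition _ := GRing.Zmodule.on quot_algebra.

Definition quot_proj (u : A) : quot_algebra :=
  (\pi_(Quotient.quot ideal_pred) u)%qT.

Definition quot_repr (x : quot_algebra) : A :=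
  repr (x : Quotient.quot ideal_pred).

Lemma quot_reprK x : quot_proj (quot_repr x) = x.
Proof. exact: reprK. Qed.

Lemma quot_projP u v : quot_proj u = quot_proj v <-> ideal_gen rel (u - v).
Proof.
rewrite (rwP eqP) (rwP (ideal_predP _)).
by rewrite /quot_proj -Quotient.idealrBE.
Qed.

Lemma quot_projD : {morph quot_proj : u v / u + v}.
Proof. by move=> u v; rewrite /quot_proj; exact: Quotient.pi_add. Qed.

Lemma quot_proj0 : quot_proj 0 = 0.
Proof. by apply: (addrI (quot_proj 0)); rewrite -quot_projD !addr0. Qed.

Lemma quot_proj_repr u : ideal_gen rel (quot_repr (quot_proj u) - u).
Proof. by apply/quot_projP; rewrite quot_reprK. Qed.

Definition quot_one : quot_algebra := quot_proj 1.

Definition quot_mul (x y : quot_algebra) : quot_algebra :=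
  quot_proj (quot_repr x * quot_repr y).

Definition quot_scale (c : F) (x : quot_algebra) : quot_algebra :=
  quot_proj (c *: quot_repr x).

Lemma ideal_genD u v :
  ideal_gen rel u -> ideal_gen rel v -> ideal_gen rel (u + v).
Proof.
move=> uI vI; rewrite -[v]opprK -[- v]add0r.
by apply: ideal_genB => //; apply: ideal_genB => //; apply: ideal_gen0.
Qed.

Lemma quot_projM : {morph quot_proj : u v / u * v >-> quot_mul u v}.
Proof.
move=> u v; apply/esym/quot_projP.
rewrite -[_ - _](subrKA (u * quot_repr (quot_proj v))) -mulrBl -mulrBr.
by apply: ideal_genD; [apply: ideal_genMr | apply: ideal_genMl];
  apply: quot_proj_repr.
Qed.

Lemma quot_projZ c : {morph quot_proj : u / c *: u >-> quot_scale c u}.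
Proof.
move=> u; apply/esym/quot_projP; rewrite -scalerBr -[_ - u]mul1r scalerAl.
by apply: ideal_genMl; apply: quot_proj_repr.
Qed.

Lemma quot_mulA : associative quot_mul.
Proof.
move=> x y z; rewrite -[x]quot_reprK -[y]quot_reprK -[z]quot_reprK.
by rewrite -!quot_projM mulrA.
Qed.

Lemma quot_mul1 : left_id quot_one quot_mul.
Proof. by move=> x; rewrite -[x]quot_reprK -quot_projM mul1r. Qed.

Lemma quot_mulr1 : right_id quot_one quot_mul.
Proof. by move=> x; rewrite -[x]quot_reprK -quot_projM mulr1. Qed.

Lemma quot_mulDl : left_distributive quot_mul +%R.
Proof.
move=> x y z; rewrite -[x]quot_reprK -[y]quot_reprK -[z]quot_reprK.
by rewrite -quot_projD -!quot_projM mulrDl quot_projD.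
Qed.

Lemma quot_mulDr : right_distributive quot_mul +%R.
Proof.
move=> x y z; rewrite -[x]quot_reprK -[y]quot_reprK -[z]quot_reprK.
by rewrite -quot_projD -!quot_projM mulrDr quot_projD.
Qed.

HB.instance Definition _ := GRing.Zmodule_isPzRing.Build quot_algebra
  quot_mulA quot_mul1 quot_mulr1 quot_mulDl quot_mulDr.

Lemma quot_scaleA c d x :
  quot_scale c (quot_scale d x) = quot_scale (c * d) x.
Proof. by rewrite -[x]quot_reprK -!quot_projZ scalerA. Qed.

Lemma quot_scale1 : left_id 1 quot_scale.
Proof. by move=> x; rewrite -[x]quot_reprK -quot_projZ scale1r. Qed.

Lemma quot_scaleDr : right_distributive quot_scale +%R.
Proof.
move=> c x y; rewrite -[x]quot_reprK -[y]quot_reprK.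
by rewrite -quot_projD -!quot_projZ scalerDr quot_projD.
Qed.

Lemma quot_scaleDl x : {morph quot_scale^~ x : c d / c + d}.
Proof.
by move=> c d; rewrite -[x]quot_reprK -!quot_projZ scalerDl quot_projD.
Qed.

HB.instance Definition _ := GRing.Zmodule_isLmodule.Build F quot_algebra
  quot_scaleA quot_scale1 quot_scaleDr quot_scaleDl.

Lemma quot_scalerAl (c : F) (x y : quot_algebra) : c *: (x * y) = c *: x * y.
Proof.
rewrite -[x]quot_reprK -[y]quot_reprK.
rewrite -[_ * _]quot_projM -[LHS]quot_projZ scalerAl.
by rewrite [LHS]quot_projM [X in quot_mul X _]quot_projZ.
Qed.

Lemma quot_scalerAr (c : F) (x y : quot_algebra) : c *: (x * y) = x * (c *: y).
Proof.
rewrite -[x]quot_reprK -[y]quot_reprK.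
rewrite -[_ * _]quot_projM -[LHS]quot_projZ scalerAr.
by rewrite [LHS]quot_projM [X in quot_mul _ X]quot_projZ.
Qed.

End IdealQuotient.

Section FreeAlgebra.

Variables (F : comNzRingType) (T : choiceType).

Definition free_algebra : Type := {malg F[{fmonom T}]}.

HB.instance Definition _ := GRing.Lalgebra.on free_algebra.

Definition free_gen (x : T) : free_algebra := << fmu x >>.

Lemma free_scalerAr (c : F) (u v : free_algebra) : c *: (u * v) = u * (c *: v).
Proof.
have malgC_comm (g : {malg F[{fmonom T}]}) : c%:MP * g = g * c%:MP.
  rewrite !malgM_def fgmulUg fgmulgU; apply: eq_bigr => m _.
  by rewrite mul1m mulm1 mulrC.
by rewrite -!mul_malgC mulrA malgC_comm -mulrA.
Qed.

HB.instance Definition _ :=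
  GRing.Lalgebra_isAlgebra.Build F free_algebra free_scalerAr.

Variable h : T -> F.

Definition fmonom_eval (m : {fmonom T}) : F := \prod_(x <- (m : seq T)) h x.

Lemma fmonom_eval_mmorphism : mmorphism fmonom_eval.
Proof.
split=> [m1 m2|]; rewrite /fmonom_eval; first by rewrite fmM big_cat.
by rewrite fm1 big_nil.
Qed.

HB.instance Definition _ :=
  monalg.isMultiplicative.Build {fmonom T} F fmonom_eval fmonom_eval_mmorphism.

Definition free_eval : {rmorphism free_algebra -> F} :=
  [the {rmorphism {malg F[{fmonom T}]} -> F} of mmap idfun fmonom_eval].

Lemma free_eval_gen x : free_eval (free_gen x) = h x.
Proof. by rewrite /= mmapU mul1r /fmonom_eval fmU big_seq1. Qed.

Lemma free_eval_ideal (rel : free_algebra -> free_algebra -> Prop) :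
    (forall u v, rel u v -> free_eval u = free_eval v) ->
  forall u, ideal_gen rel u -> free_eval u = 0.
Proof.
move=> hrel u; elim=> {u} [u v /hrel uv||u v _ u0 _ v0|u v _ v0|u v _ u0].
- by rewrite rmorphB uv subrr.
- exact: rmorph0.
- by rewrite rmorphB u0 v0 subrr.
- by rewrite rmorphM v0 mulr0.
- by rewrite rmorphM u0 mul0r.
Qed.

End FreeAlgebra.

Definition tau_range (k i : nat) : bool := (2 <= i <= 2 * k - 1)%N.
Definition e_range (k i : nat) : bool := (1 <= i <= 2 * k - 1)%N.
Definition x_range (k i : nat) : bool := (1 <= i <= 2 * k)%N.

(* The generators tau_i, e_i, x_i and z_l, in this order. *)
Definition affine_gen (k : nat) : choiceType :=
  ({i : nat | tau_range k i} + {i : nat | e_range k i}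
   + {i : nat | x_range k i} + nat)%type.

Section AffineRelations.

Variables (k : nat) (A : nzRingType) (t e x z : nat -> A).

Definition aff_s (j : nat) : A := t (2 * j) * t (2 * j + 1) + e (2 * j).

Local Notation s := aff_s.
Local Notation in_t := (tau_range k).
Local Notation in_e := (e_range k).
Local Notation in_x := (x_range k).

(* Conditions such as j <> i - 1 are written i != j + 1 to avoid truncated
   subtraction. *)
Inductive affine_rel : A -> A -> Prop :=
  | rel_tau_even_sq i of (1 <= i <= k - 1)%N :
      affine_rel (t (2 * i) ^+ 2) (1 - e (2 * i))
  | rel_tau_odd_sq i of (1 <= i <= k - 1)%N :
      affine_rel (t (2 * i + 1) ^+ 2) (1 - e (2 * i))

  | rel_tau_odd_even i j of in_t (2 * i + 1) & in_t (2 * j) & j != (i + 1)%N :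
      affine_rel (t (2 * i + 1) * t (2 * j)) (t (2 * j) * t (2 * i + 1))
  | rel_tau_odd_odd i j of in_t (2 * i + 1) & in_t (2 * j + 1)
      & i != (j + 1)%N & j != (i + 1)%N :
      affine_rel (t (2 * i + 1) * t (2 * j + 1)) (t (2 * j + 1) * t (2 * i + 1))
  | rel_tau_even_even i j of in_t (2 * i) & in_t (2 * j)
      & i != (j + 1)%N & j != (i + 1)%N :
      affine_rel (t (2 * i) * t (2 * j)) (t (2 * j) * t (2 * i))
  | rel_s_braid i of (1 <= i <= k - 2)%N :
      affine_rel (s i * s (i + 1) * s i) (s (i + 1) * s i * s (i + 1))

  | rel_e_odd_sq i of (1 <= i <= k)%N :
      affine_rel (e (2 * i - 1) ^+ 2) (z 0 * e (2 * i - 1))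
  | rel_e_even_sq i of (1 <= i <= k - 1)%N :
      affine_rel (e (2 * i) ^+ 2) (e (2 * i))
  | rel_tau_odd_e i of (1 <= i <= k - 1)%N :
      affine_rel (t (2 * i + 1) * e (2 * i)) 0
  | rel_e_tau_odd i of (1 <= i <= k - 1)%N :
      affine_rel (e (2 * i) * t (2 * i + 1)) 0
  | rel_tau_even_e i of (1 <= i <= k - 1)%N :
      affine_rel (t (2 * i) * e (2 * i)) 0
  | rel_e_tau_even i of (1 <= i <= k - 1)%N :
      affine_rel (e (2 * i) * t (2 * i)) 0
  | rel_tau_ee i of (1 <= i <= k - 1)%N :
      affine_rel (t (2 * i) * e (2 * i - 1) * e (2 * i + 1))
                 (t (2 * i + 1) * e (2 * i - 1) * e (2 * i + 1))
  | rel_ee_tau i of (1 <= i <= k - 1)%N :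
      affine_rel (e (2 * i + 1) * e (2 * i - 1) * t (2 * i))
                 (e (2 * i + 1) * e (2 * i - 1) * t (2 * i + 1))

  | rel_e_e i j of in_e i & in_e j & (i + 2 <= j)%N || (j + 2 <= i)%N :
      affine_rel (e i * e j) (e j * e i)
  | rel_tau_odd_e_odd i j of in_t (2 * i - 1) & in_e (2 * j - 1)
      & i != (j + 1)%N & j != i :
      affine_rel (t (2 * i - 1) * e (2 * j - 1)) (e (2 * j - 1) * t (2 * i - 1))
  | rel_tau_odd_e_even i j of in_t (2 * i - 1) & in_e (2 * j) & j != i :
      affine_rel (t (2 * i - 1) * e (2 * j)) (e (2 * j) * t (2 * i - 1))
  | rel_tau_even_e_odd i j of in_t (2 * i) & in_e (2 * j - 1)
      & j != i & j != (i + 1)%N :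
      affine_rel (t (2 * i) * e (2 * j - 1)) (e (2 * j - 1) * t (2 * i))
  | rel_tau_even_e_even i j of in_t (2 * i) & in_e (2 * j) & i != (j + 1)%N :
      affine_rel (t (2 * i) * e (2 * j)) (e (2 * j) * t (2 * i))

  | rel_eee_up i of (1 <= i <= 2 * k - 2)%N :
      affine_rel (e i * e (i + 1) * e i) (e i)
  | rel_eee_down i of (1 <= i <= 2 * k - 2)%N :
      affine_rel (e (i + 1) * e i * e (i + 1)) (e (i + 1))
  | rel_tau_e_odd_tau i of (1 <= i <= k - 1)%N :
      affine_rel (t (2 * i) * e (2 * i - 1) * t (2 * i))
                 (t (2 * i + 1) * e (2 * i + 1) * t (2 * i + 1))
  | rel_tau_e_even_tau i of (2 <= i <= k - 1)%N :
      affine_rel (t (2 * i) * e (2 * i - 2) * t (2 * i))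
                 (t (2 * i - 1) * e (2 * i) * t (2 * i - 1))

  | rel_x_x i j of in_x i & in_x j :
      affine_rel (x i * x j) (x j * x i)
  | rel_tau_x i j of in_t i & in_x j & i != (j + 1)%N & j != i & j != (i + 1)%N :
      affine_rel (t i * x j) (x j * t i)
  | rel_e_x i j of in_e i & in_x j & j != i & j != (i + 1)%N :
      affine_rel (e i * x j) (x j * e i)

  | rel_tau_braid_even i of in_t (2 * i - 2) & in_t (2 * i) & in_e (2 * i - 2) :
      affine_rel (t (2 * i - 2) * t (2 * i) * t (2 * i - 2))
                 (t (2 * i) * t (2 * i - 2) * t (2 * i) * (1 - e (2 * i - 2)))
  | rel_tau_braid_odd i of in_t (2 * i + 1) & in_t (2 * i - 1) & in_e (2 * i) :
      affine_rel (t (2 * i + 1) * t (2 * i - 1) * t (2 * i + 1))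
                 (t (2 * i - 1) * t (2 * i + 1) * t (2 * i - 1) * (1 - e (2 * i)))
  | rel_tau_odd_even_odd i of in_t (2 * i - 1) & in_t (2 * i) & in_e (2 * i - 2) :
      affine_rel (t (2 * i - 1) * t (2 * i) * t (2 * i - 1))
                 (t (2 * i) - e (2 * i - 2) * t (2 * i) - t (2 * i) * e (2 * i - 2))
  | rel_tau_even_odd_even i of in_t (2 * i) & in_t (2 * i - 1) & in_e (2 * i) :
      affine_rel (t (2 * i) * t (2 * i - 1) * t (2 * i))
                 (t (2 * i - 1) - e (2 * i) * t (2 * i - 1) - t (2 * i - 1) * e (2 * i))

  | rel_x_odd_next i of in_x (2 * i + 1) & in_t (2 * i) & in_x (2 * i - 1)
      & in_e (2 * i) & in_e (2 * i - 1) :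
      affine_rel (x (2 * i + 1))
        (t (2 * i) * x (2 * i - 1) * t (2 * i) + e (2 * i) * e (2 * i - 1) * t (2 * i)
         + t (2 * i) * e (2 * i - 1) * e (2 * i) - t (2 * i))
  | rel_x_even_next i of in_x (2 * i + 2) & in_t (2 * i + 1) & in_x (2 * i)
      & in_e (2 * i) & in_e (2 * i + 1) :
      affine_rel (x (2 * i + 2))
        (t (2 * i + 1) * x (2 * i) * t (2 * i + 1)
         + e (2 * i) * e (2 * i + 1) * t (2 * i + 1) * e (2 * i + 1) * e (2 * i)
         + t (2 * i + 1))
  | rel_x_even i of in_x (2 * i) & in_t (2 * i) & in_e (2 * i) & in_e (2 * i - 1) :
      affine_rel (x (2 * i))
        (t (2 * i) * x (2 * i) * t (2 * i) + e (2 * i) * e (2 * i - 1) * t (2 * i)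
         + t (2 * i) * e (2 * i - 1) * e (2 * i))
  | rel_x_odd i of in_x (2 * i + 1) & in_t (2 * i + 1) & in_e (2 * i)
      & in_e (2 * i + 1) :
      affine_rel (x (2 * i + 1))
        (t (2 * i + 1) * x (2 * i + 1) * t (2 * i + 1)
         + e (2 * i) * e (2 * i + 1) * t (2 * i + 1)
         + t (2 * i + 1) * e (2 * i + 1) * e (2 * i))

  | rel_e_xx i of (1 <= i <= 2 * k - 1)%N :
      affine_rel (e i * (x i - x (i + 1))) 0
  | rel_xx_e i of (1 <= i <= 2 * k - 1)%N :
      affine_rel ((x i - x (i + 1)) * e i) 0

  | rel_e_xl_e l of (1 <= l)%N & in_e 1 & in_x 1 :
      affine_rel (e 1 * x 1 ^+ l * e 1) (z l * e 1)
  | rel_z_central l u :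
      affine_rel (z l * u) (u * z l).

End AffineRelations.

Lemma affine_rel_morph k (A B : nzRingType) (f : {rmorphism A -> B})
    (t e x z : nat -> A) (t' e' x' z' : nat -> B) :
    (forall i, tau_range k i -> f (t i) = t' i) ->
    (forall i, e_range k i -> f (e i) = e' i) ->
    (forall i, x_range k i -> f (x i) = x' i) ->
    (forall l, f (z l) = z' l) ->
  forall u v, affine_rel k t e x z u v ->
    affine_rel k t' e' x' z' (f u) (f v).
Proof.
move=> ft fe fx fz u v; case=> {u v}.
all: rewrite /aff_s /tau_range /e_range /x_range => *.
all: rewrite ?(rmorphD, rmorphN, rmorphM, rmorphXn, rmorph1, rmorph0).
all: rewrite ?ft ?fe ?fx ?fz; try by rewrite /tau_range /e_range /x_range; lia.
all: by solve [constructor; rewrite /tau_range /e_range /x_range //; lia].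
Qed.

(* Outside its range a generator is read as 0; the relations only involve
   generators in range. *)
HB.lock Definition free_tau (F : comNzRingType) (k i : nat) :
    free_algebra F (affine_gen k) :=
  if insub i is Some u then free_gen F (inl (inl (inl u))) else 0.

HB.lock Definition free_e (F : comNzRingType) (k i : nat) :
    free_algebra F (affine_gen k) :=
  if insub i is Some u then free_gen F (inl (inl (inr u))) else 0.

HB.lock Definition free_x (F : comNzRingType) (k i : nat) :
    free_algebra F (affine_gen k) :=
  if insub i is Some u then free_gen F (inl (inr u)) else 0.

HB.lock Definition free_z (F : comNzRingType) (k l : nat) :
    free_algebra F (affine_gen k) := free_gen F (inr l).

Definition free_rel (F : comNzRingType) (k : nat) :
    free_algebra F (affine_gen k) -> free_algebra F (affine_gen k) -> Prop :=
  affine_rel k (free_tau F k) (free_e F k) (free_x F k) (free_z F k).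

Definition affine_partition_algebra (F : comNzRingType) (k : nat) : Type :=
  quot_algebra (@free_rel F k).

HB.instance Definition _ F k := GRing.PzRing.on (affine_partition_algebra F k).
HB.instance Definition _ F k :=
  GRing.Lmodule.copy (affine_partition_algebra F k)
    (quot_algebra (@free_rel F k)).

Definition character_x (F : pzRingType) (i : nat) : F :=
  if odd i then - i./2%:R else i./2%:R.

Lemma affine_rel_character (F : comNzRingType) (k : nat) (u v : F) :
  affine_rel k (fun=> 1) (fun=> 0) (character_x F) (fun=> 0) u v -> u = v.
Proof.
have xo i : character_x F (2 * i + 1) = - i%:R.
  by rewrite /character_x addn1 mul2n /= odd_double uphalf_double.
have xe i : character_x F (2 * i) = i%:R.
  by rewrite /character_x mul2n odd_double doubleK.
have x_odd_next i : tau_range k (2 * i) ->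
    character_x F (2 * i + 1) = character_x F (2 * i - 1) - 1.
  rewrite /tau_range => i_t; have i_gt0 : (0 < i)%N by lia.
  have -> : (2 * i - 1 = 2 * i.-1 + 1)%N by lia.
  by rewrite !xo -{1}(prednK i_gt0) mulrS opprD addrC.
have x_even_next i : character_x F (2 * i + 2) = character_x F (2 * i) + 1.
  have -> : (2 * i + 2 = 2 * i.+1)%N by lia.
  by rewrite !xe mulrS addrC.
case=> {u v}; rewrite /aff_s => *; rewrite ?(mulr0, mul0r, mulr1, mul1r) //;
  rewrite ?(expr1n, expr0n, addr0, add0r, subr0, mulr1, mul1r, mul0r) //.
all: by [exact: mulrC | exact: x_odd_next | exact: x_even_next].
Qed.

Section AffinePartitionAlgebra.

Variables (F : comNzRingType) (k : nat).
Local Notation AA := (affine_partition_algebra F k).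

(* The algebra is nonzero: tau_i |-> 1, e_i |-> 0, z_l |-> 0, x_(2i+1) |-> - i,
   x_(2i) |-> i is a character. *)
Definition affine_character (g : affine_gen k) : F :=
  match g with
  | inl (inl (inl _)) => 1
  | inl (inl (inr _)) => 0
  | inl (inr r) => character_x F (val r)
  | inr _ => 0
  end.

Local Notation ev := (free_eval affine_character).

Lemma ev_tau i : tau_range k i -> ev (free_tau F k i) = 1.
Proof. by move=> h; rewrite free_tau.unlock insubT free_eval_gen. Qed.

Lemma ev_e i : ev (free_e F k i) = 0.
Proof.
by rewrite free_e.unlock; case: insubP => [u _ _|_]; rewrite ?free_eval_gen ?rmorph0.
Qed.

Lemma ev_x i : x_range k i ->
  ev (free_x F k i) = character_x F i.
Proof. by move=> h; rewrite free_x.unlock insubT free_eval_gen. Qed.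

Lemma ev_z l : ev (free_z F k l) = 0.
Proof. by rewrite free_z.unlock free_eval_gen. Qed.

Lemma ev_rel u v : free_rel u v -> ev u = ev v.
Proof.
move=> uv; apply: (@affine_rel_character F k).
by apply: affine_rel_morph uv => [i /ev_tau|i _|i /ev_x|l] //;
  [exact: ev_e | exact: ev_z].
Qed.

Lemma affine_one_neq0 : (1 : AA) != 0.
Proof.
apply/eqP; rewrite -(quot_proj0 (@free_rel F k)) => /quot_projP.
rewrite subr0 => /(free_eval_ideal ev_rel) /eqP.
by rewrite rmorph1 oner_eq0.
Qed.

HB.instance Definition _ := GRing.PzSemiRing_isNonZero.Build AA affine_one_neq0.
HB.instance Definition _ := GRing.Lmodule_isLalgebra.Build F AA
  (@quot_scalerAl F _ (@free_rel F k)).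
HB.instance Definition _ := GRing.Lalgebra_isAlgebra.Build F AA
  (@quot_scalerAr F _ (@free_rel F k)).

Definition aff_tau (i : nat) : AA := quot_proj _ (free_tau F k i).
Definition aff_e (i : nat) : AA := quot_proj _ (free_e F k i).
Definition aff_x (i : nat) : AA := quot_proj _ (free_x F k i).
Definition aff_z (l : nat) : AA := quot_proj _ (free_z F k l).

End AffinePartitionAlgebra.

(* Main.v *)
Require Import Defs.
From HB Require Import structures.
From mathcomp Require Import all_boot all_order all_algebra all_fingroup.
From mathcomp Require Import reals complex boolp monalg zify ring.

(* The partition algebra acts on the functions of k colours, each diagram
   summing over the colourings compatible with it and z acting as the number n
   of colours; by triangularity with respect to refinement, and since nonzero
   polynomials do not vanish at infinitely many n, an element acting as 0 for
   all n is 0. On a colouring a_1, ..., a_k, Enyang's elements are transparent: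
   sigma_(2i) and sigma_(2i+1) apply the transposition (a_i a_(i+1)) to the
   first i-1, resp. i+1, colours, while L_(2i) and z - L_(2i-1) sum over all
   colours b the transposition (a_i b) applied to the first i, resp. i-1,
   colours.  Every relation of the affine algebra then becomes an identity
   between sums of recolourings. For surjectivity, cutting and merging blocks
   reduces every diagram to a permutation. *)

Set Implicit Arguments.
Unset Strict Implicit.
Unset Printing Implicit Defensive.

Import Order.TTheory GRing.Theory Num.Theory.

Local Open Scope ring_scope.

(** * The universal property of the affine algebra *)

(** A colour is a Boolean vector indexed by a finite type [I]: the counting identity for stacked
    diagrams is already available for two colours, where it gave associativity, and the identity for
    [I] is its product over the bits. The number of colours is then a power of two, which still
    gives infinitely many values of z. No single number n suffices, since z - n acts as 0 on n
    colours. Elements act on functions of colourings, with u v acting as u after v on functions;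
    evaluated at a colouring, the left factor moves the colouring first, so words are read from left
    to right as successive moves. The recursions for L and sigma produce ever longer words. Once an
    induction has replaced each by a closed formula, the defining relations need no further
    induction, only the case distinction whether neighbouring colours agree. *)

Section FreeAlgebraLift.

Variables (F : comNzRingType) (T : choiceType) (B : algType F) (h : T -> B).

Definition fmonom_lift (m : {fmonom T}) : B := \prod_(x <- (m : seq T)) h x.

Lemma fmonom_lift_mmorphism : mmorphism fmonom_lift.
Proof.
split=> [m1 m2|]; rewrite /fmonom_lift; first by rewrite fmM big_cat.
by rewrite fm1 big_nil.
Qed.

HB.instance Definition _ :=
  monalg.isMultiplicative.Build {fmonom T} B fmonom_lift fmonom_lift_mmorphism.

Definition free_lift (u : free_algebra F T) : B := mmap (in_alg B) fmonom_lift u.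

Lemma free_lift_zmod_morphism : zmod_morphism free_lift.
Proof. exact: raddfB. Qed.

HB.instance Definition _ := GRing.isZmodMorphism.Build
  (free_algebra F T) B free_lift free_lift_zmod_morphism.

Lemma free_lift_monoid_morphism : monoid_morphism free_lift.
Proof.
have [|hM h1] := @commr_mmap_is_multiplicative {fmonom T} F B (in_alg B) fmonom_lift.
  (* The images of coefficients must commute with those of monomials: scalar multiples of 1 are
     central. *)
  by move=> g m m'; rewrite /GRing.comm /= -scalerAl mul1r -scalerAr mulr1.
by split.
Qed.

HB.instance Definition _ := GRing.isMonoidMorphism.Build
  (free_algebra F T) B free_lift free_lift_monoid_morphism.

Lemma free_lift_scalable : scalable free_lift.
Proof. by move=> c u; rewrite /free_lift mmapZ /= mulr_algl. Qed.

Lemma free_lift_gen x : free_lift (free_gen F x) = h x.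
Proof. by rewrite /free_lift mmapU /= /fmonom_lift fmU big_seq1 scale1r mul1r. Qed.

Lemma free_lift_ideal (rel : free_algebra F T -> free_algebra F T -> Prop) :
    (forall u v, rel u v -> free_lift u = free_lift v) ->
  forall u, ideal_gen rel u -> free_lift u = 0.
Proof.
move=> hrel u; elim=> {u} [u v /hrel uv||u v _ u0 _ v0|u v _ v0|u v _ u0].
- by rewrite rmorphB /= uv subrr.
- exact: rmorph0.
- by rewrite rmorphB /= u0 v0 subrr.
- by rewrite rmorphM /= v0 mulr0.
- by rewrite rmorphM /= u0 mul0r.
Qed.

End FreeAlgebraLift.

Section AffineLift.

Variables (F : comNzRingType) (k : nat) (B : algType F).
Variables (t e x z : nat -> B).
Hypothesis rel_eq : forall u v, affine_rel k t e x z u v -> u = v.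

Local Notation AA := (affine_partition_algebra F k).

Definition affine_gen_image (g : affine_gen k) : B :=
  match g with
  | inl (inl (inl i)) => t (val i)
  | inl (inl (inr i)) => e (val i)
  | inl (inr i) => x (val i)
  | inr l => z l
  end.

Local Notation ev := (free_lift affine_gen_image).

Let ev_tau i : tau_range k i -> ev (free_tau F k i) = t i.
Proof. by move=> h; rewrite free_tau.unlock insubT free_lift_gen. Qed.

Let ev_e i : e_range k i -> ev (free_e F k i) = e i.
Proof. by move=> h; rewrite free_e.unlock insubT free_lift_gen. Qed.

Let ev_x i : x_range k i -> ev (free_x F k i) = x i.
Proof. by move=> h; rewrite free_x.unlock insubT free_lift_gen. Qed.

Let ev_z l : ev (free_z F k l) = z l.
Proof. by rewrite free_z.unlock free_lift_gen. Qed.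

Lemma free_lift_rel u v : free_rel u v -> ev u = ev v.
Proof.
by move=> uv; apply/rel_eq/(affine_rel_morph ev_tau ev_e ev_x ev_z uv).
Qed.

Definition affine_lift (y : AA) : B := ev (quot_repr y).

(** Independence of the representative: the chosen one differs from [u] by an element of the ideal,
    which [ev] kills. *)
Lemma affine_lift_proj u : affine_lift (quot_proj _ u) = ev u.
Proof.
apply/eqP; rewrite -subr_eq0 -rmorphB; apply/eqP.
exact: (free_lift_ideal free_lift_rel) (quot_proj_repr _ _).
Qed.

Lemma affine_lift_zmod_morphism : zmod_morphism affine_lift.
Proof.
move=> u v; rewrite -[u]quot_reprK -[v]quot_reprK.
have -> : quot_proj _ (quot_repr u) - quot_proj _ (quot_repr v)
    = quot_proj _ (quot_repr u - quot_repr v) :> AA.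
  by apply/eqP; rewrite subr_eq -quot_projD subrK.
by rewrite !affine_lift_proj rmorphB.
Qed.

HB.instance Definition _ := GRing.isZmodMorphism.Build
  AA B affine_lift affine_lift_zmod_morphism.

Lemma affine_lift_monoid_morphism : monoid_morphism affine_lift.
Proof.
split; first by rewrite affine_lift_proj rmorph1.
move=> u v; rewrite -[u]quot_reprK -[v]quot_reprK.
by rewrite -[_ * _]quot_projM !affine_lift_proj rmorphM.
Qed.

HB.instance Definition _ := GRing.isMonoidMorphism.Build
  AA B affine_lift affine_lift_monoid_morphism.

Lemma affine_lift_scalable : scalable affine_lift.
Proof.
move=> c u; rewrite -[u]quot_reprK -[_ *: _]quot_projZ !affine_lift_proj.
exact: free_lift_scalable.
Qed.

HB.instance Definition _ := GRing.isScalable.Build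
  F AA B *:%R affine_lift affine_lift_scalable.

Lemma affine_algebra_universal : exists pr : {lrmorphism AA -> B},
  [/\ forall i, tau_range k i -> pr (aff_tau F k i) = t i,
      forall i, e_range k i -> pr (aff_e F k i) = e i,
      forall i, x_range k i -> pr (aff_x F k i) = x i
    & forall l, pr (aff_z F k l) = z l].
Proof.
exists affine_lift; split=> [i|i|i|l] *; rewrite /= affine_lift_proj.
- exact: ev_tau.
- exact: ev_e.
- exact: ev_x.
- exact: ev_z.
Qed.

End AffineLift.

(** * The action on colourings *)

(** The offset [c] leaves room for the bits that encode the blocks of a diagram. *)
Lemma poly_eq0_pow2 (F : numDomainType) (c : nat) (p : {poly F}) :
  (forall m, p.[(2 ^ (c + m))%:R] = 0) -> p = 0.
Proof.
move=> h; apply/eqP/negP=> /negP p0.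
pose rs := [seq (2 ^ (c + m))%:R : F | m <- iota 0 (size p)].
have all_rs : all (root p) rs by apply/allP=> _ /mapP[m _ ->]; apply/eqP/h.
have uniq_rs : uniq rs.
  rewrite map_inj_uniq ?iota_uniq // => m m' /eqP.
  by rewrite eqr_nat eqn_exp2l // eqn_add2l => /eqP.
by have := max_poly_roots p0 all_rs uniq_rs; rewrite size_map size_iota ltnn.
Qed.

Section ColourCompatibility.

Variables (k : nat) (I : finType).
Local Notation T := {ffun I -> bool}.
Local Notation row := {ffun 'I_k -> T}.
Implicit Types (a b c : row) (d : diagram k).

Definition row_colour a b (v : vertex k) : T :=
  match v with inl i => a i | inr i => b i end.

Definition row_bit (l : I) a : {ffun 'I_k -> bool} := [ffun i => a i l].

Definition row_compatible d a b : bool :=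
  [forall l, compatible d (row_bit l a) (row_bit l b)].

Lemma row_compatibleP d a b :
  reflect (forall u v, same_block d u v -> row_colour a b u = row_colour a b v)
          (row_compatible d a b).
Proof.
have bitE l u : colour (row_bit l a) (row_bit l b) u = row_colour a b u l.
  by case: u => i /=; rewrite ffunE.
apply: (iffP forallP) => [h u v uv | h l].
  by apply/ffunP=> l; rewrite -!bitE; have /compatibleP := h l; apply.
by apply/compatibleP=> u v /h E; rewrite !bitE E.
Qed.

Lemma row_compatibleE d a b :
  (row_compatible d a b = \prod_l compatible d (row_bit l a) (row_bit l b) :> nat)%N.
Proof.
rewrite /row_compatible; case: forallP => [h | /forallP].
  by rewrite big1 // => l _; rewrite h.
by rewrite negb_forall => /existsP[l /negbTE h]; rewrite (bigD1 l) //= h.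
Qed.

(* A colour is a vector of bits, so this is the product over the bits of the
   count with two colours. *)
Lemma row_compatible_stack d d' a c :
  (\sum_b row_compatible d a b * row_compatible d' b c
    = #|T| ^ loops d d' * row_compatible (Defs.comp d d') a c)%N.
Proof.
pose G l (y : {ffun 'I_k -> bool}) : nat :=
  (compatible d (row_bit l a) y * compatible d' y (row_bit l c))%N.
transitivity (\sum_(g : {ffun I -> {ffun 'I_k -> bool}}) \prod_l G l (g l))%N.
  (* Transposition: a row of bit vectors is a family, indexed by the bits, of two-coloured rows. *)
  rewrite (reindex (fun g : {ffun I -> {ffun 'I_k -> bool}} =>
                      [ffun i => [ffun l => g l i]] : row)) /=; last first.
    exists (fun b : row => [ffun l => row_bit l b]) => b _.
      by apply/ffunP=> l; apply/ffunP=> i; rewrite !ffunE.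
    by apply/ffunP=> i; apply/ffunP=> l; rewrite !ffunE.
  apply: eq_bigr => g _; rewrite !row_compatibleE -big_split /=.
  apply: eq_bigr => l _; rewrite /G.
  suff -> : row_bit l [ffun i => [ffun l => g l i]] = g l by [].
  by apply/ffunP=> i; rewrite !ffunE.
rewrite -(bigA_distr_bigA G); under eq_bigr do rewrite compatible_stack_sum.
rewrite big_split /= row_compatibleE prod_nat_const card_ffun card_bool -!expnM.
by rewrite mulnC [in RHS]mulnC [(_ * #|_|)%N]mulnC.
Qed.

End ColourCompatibility.

Section Action.

Variables (F : numDomainType) (k : nat) (I : finType).
Local Notation T := {ffun I -> bool}.
Local Notation row := {ffun 'I_k -> T}.
Local Notation PA := (partition_algebra F k).
Implicit Types (a : nat -> T) (b c : row) (d : diagram k) (u v : PA).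
Implicit Types f g : (nat -> T) -> F.

Definition row_of a : row := [ffun i : 'I_k => a i.+1].

(** Colourings live on all of [nat], so that shifting a position needs no bound; positions outside
    1, ..., k keep the colour they have in [a]. *)
Definition set_row a b (j : nat) : T :=
  if j is j'.+1 then if insub j' is Some i then b i else a j else a j.

Lemma row_of_set a b : row_of (set_row a b) = b.
Proof.
by apply/ffunP=> i; rewrite ffunE /= valK.
Qed.

Lemma set_row_of a : set_row a (row_of a) = a.
Proof.
apply/funext=> -[|j]; rewrite /set_row //.
by case: insubP => [i _ ji|] //; rewrite ffunE ji.
Qed.

Lemma set_set_row a b c : set_row (set_row a b) c = set_row a c.
Proof.
by apply/funext=> -[|j]; rewrite /set_row //; case: insubP.
Qed.

Definition diagram_act d f a : F :=
  \sum_b (row_compatible d (row_of a) b)%:R * f (set_row a b).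

(* The permutation action on tensor space: [f] is a function of the colours of
   the positions 1, ..., k, and z is the number of colours. *)
Definition act u f a : F := \sum_d (u d).[#|T|%:R] * diagram_act d f a.

Lemma act_diagram d f a : act (pa_diagram F d) f a = diagram_act d f a.
Proof.
rewrite /act (bigD1 d) //= big1 ?addr0 => [|d' /negbTE ne].
  by rewrite pa_diagramE eqxx hornerC mul1r.
by rewrite pa_diagramE ne hornerC mul0r.
Qed.

Lemma diagram_act_id f a : diagram_act (id_diagram k) f a = f a.
Proof.
have compE b : row_compatible (id_diagram k) (row_of a) b = (b == row_of a).
  apply/row_compatibleP/eqP => [h|-> [i|i] [j|j]]; last 4 first.
  - by rewrite same_block_fibres => /eqP ->.
  - by rewrite same_block_fibres => /eqP ->.
  - by rewrite same_block_fibres => /eqP ->.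
  - by rewrite same_block_fibres => /eqP ->.
  by apply/ffunP=> i; have /= -> := h (inr i) (inl i) _; rewrite ?same_block_fibres.
rewrite /diagram_act (bigD1 (row_of a)) //= compE eqxx mul1r set_row_of.
by rewrite big1 ?addr0 // => b /negbTE ne; rewrite compE ne mul0r.
Qed.

Lemma act1 f : act 1 f = f.
Proof. by apply/funext=> a; rewrite act_diagram diagram_act_id. Qed.

Lemma actD u v f : act (u + v) f = (fun a => act u f a + act v f a).
Proof.
apply/funext=> a; rewrite /act -big_split /=; apply: eq_bigr => d _.
by rewrite ffunE hornerD mulrDl.
Qed.

Lemma actN u f : act (- u) f = (fun a => - act u f a).
Proof.
apply/funext=> a; rewrite /act -sumrN; apply: eq_bigr => d _.
by rewrite ffunE hornerN mulNr.
Qed.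

Lemma actB u v f : act (u - v) f = (fun a => act u f a - act v f a).
Proof. by rewrite actD actN. Qed.

Lemma act0 f : act 0 f = (fun=> 0).
Proof.
apply/funext=> a; rewrite /act big1 // => d _.
by rewrite ffunE horner0 mul0r.
Qed.

Lemma act_z f : act (pa_z F k) f = (fun a => #|T|%:R * f a).
Proof.
apply/funext=> a; rewrite /act (bigD1 (id_diagram k)) //= big1 ?addr0.
  by rewrite pa_zE eqxx hornerX diagram_act_id.
by move=> d /negbTE ne; rewrite pa_zE ne horner0 mul0r.
Qed.

(** Each component in the middle row is coloured freely and contributes a factor [#|T|], the value
    of z. *)
Lemma diagram_act_comp d d' f a : diagram_act d (diagram_act d' f) a
  = #|T|%:R ^+ loops d d' * diagram_act (Defs.comp d d') f a.
Proof.
rewrite /diagram_act mulr_sumr.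
under eq_bigr => b _ do rewrite mulr_sumr.
rewrite exchange_big; apply: eq_bigr => c _ /=.
rewrite mulrA -natrX -natrM -row_compatible_stack natr_sum mulr_suml.
by apply: eq_bigr => b _; rewrite row_of_set set_set_row natrM mulrA.
Qed.

Lemma actM u v f : act (u * v) f = act u (act v f).
Proof.
apply/funext=> a.
(* The convolution defining the product is paired with the constants [diagram_act d f a] and
   evaluated at z = [#|T|]. *)
have := congr1 (fun p => p.[#|T|%:R])
  (sum_pa_mul u v (fun d => (diagram_act d f a)%:P)).
rewrite !horner_sum /act => E; transitivity (\sum_d
  (pa_mul u v d * (diagram_act d f a)%:P).[#|T|%:R]).
  by apply: eq_bigr => d _; rewrite hornerM hornerC.
rewrite E; apply: eq_bigr => d _; rewrite horner_sum /diagram_act.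
under [in RHS]eq_bigr => b _ do rewrite mulr_sumr.
rewrite exchange_big mulr_sumr /=; apply: eq_bigr => d' _.
rewrite !hornerM hornerXn hornerC mulrAC -(diagram_act_comp d d' f a).
rewrite mulrC -mulrA; congr (_ * _); rewrite mulr_sumr.
by apply: eq_bigr => b _; rewrite mulrCA.
Qed.

End Action.

(** A colouring whose fibres are exactly the blocks of [d] is compatible only with refinements of
    [d]. A proper refinement relates fewer pairs of vertices, so its coefficient is already known to
    vanish; testing on the indicator of the bottom row leaves the value of [w d] alone. *)
Lemma act_faithful (F : numDomainType) (k : nat) (u v : partition_algebra F k) :
  (forall (I : finType) (f : (nat -> {ffun I -> bool}) -> F),
     act u f = act v f) ->
  u = v.
Proof.
move=> h; apply/eqP; rewrite -subr_eq0; apply/eqP.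
have {h} : forall (I : finType) (f : (nat -> {ffun I -> bool}) -> F) a,
    act (u - v) f a = 0 by move=> I f a; rewrite actB h subrr.
move: (u - v) => {u v} w h.
suff w0 n d : (#|[set p | same_block d p.1 p.2]| < n)%N -> w d = 0.
  by apply/ffunP=> d; rewrite ffunE; apply: w0 (ltnSn _).
elim: n d => // n IH d; rewrite ltnS => dn.
apply: (@poly_eq0_pow2 _ #|vertex k|) => m.
(* The bits in [vertex k] record the characteristic vector of a block; the [m] padding bits vary the
   number of colours. *)
pose I : finType := (vertex k + 'I_m)%type.
pose col (x : vertex k) : {ffun I -> bool} :=
  [ffun l => if l is inl y then same_block d x y else false].
have colE x y : (col x = col y) <-> same_block d x y.
  split=> [/ffunP/(_ (inl y))|xy]; first by rewrite !ffunE same_block_refl.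
  apply/ffunP=> -[l|l]; rewrite !ffunE //.
  by have [_ ->] := partition_same_block d x y l.
pose a0 := [ffun i : 'I_k => col (inl i)].
pose c0 := [ffun i : 'I_k => col (inr i)].
have rowE x : row_colour a0 c0 x = col x by case: x => i /=; rewrite ffunE.
pose a := set_row (fun=> [ffun=> false]) a0.
have := h I (fun g => (row_of k g == c0)%:R) a.
have cT : #|{: {ffun I -> bool}}| = (2 ^ (#|vertex k| + m))%N.
  by rewrite card_ffun card_bool card_sum card_ord.
have daE d' : diagram_act d' (fun g => (row_of k g == c0)%:R) a
    = (row_compatible d' a0 c0)%:R :> F.
  rewrite /diagram_act (bigD1 c0) //= !row_of_set eqxx mulr1.
  by rewrite big1 ?addr0 // => b /negbTE ne; rewrite row_of_set ne mulr0.
rewrite /act cT (bigD1 d) //= daE.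
have -> : row_compatible d a0 c0.
  by apply/row_compatibleP => x y; rewrite !rowE colE.
rewrite mulr1 big1 ?addr0 // => d' ne; rewrite daE.
case: row_compatibleP => [sub|_]; last by rewrite mulr0.
rewrite IH ?horner0 ?mul0r //; apply: leq_trans dn; apply/proper_card/properP.
have sub' x y : same_block d' x y -> same_block d x y.
  by move=> /sub; rewrite !rowE colE.
split; first by apply/subsetP=> -[x y]; rewrite !inE; apply: sub'.
have [/existsP[x /existsP[y /andP[xy nxy]]]|/existsPn no] :=
  boolP [exists x, exists y, same_block d x y && ~~ same_block d' x y].
  by exists (x, y); rewrite !inE.
case/eqP: ne; apply: same_block_inj => x y; apply/idP/idP; first exact: sub'.
by have /existsPn/(_ y) := no x; rewrite negb_and negbK; case: same_block.
Qed.

(* Positions are numbered from 1, and [a 0] is never changed. *)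
Section Colourings.

Variable T : eqType.
Implicit Types (x y c : T) (a : nat -> T) (p q : T -> T).

Definition swap x y c : T := if c == x then y else if c == y then x else c.

Definition act_upto (m : nat) p a (j : nat) : T :=
  if (0 < j <= m)%N then p (a j) else a j.

Definition recolour a (i : nat) c (j : nat) : T := if j == i then c else a j.

End Colourings.

(** This permutes positions, whereas [act_upto] permutes colours. *)
Definition swap_pos (T : Type) (i : nat) (a : nat -> T) (j : nat) : T :=
  a (swap i i.+1 j).

Section Generators.

Variables (F : numDomainType) (k : nat) (I : finType).
Local Notation T := {ffun I -> bool}.
Implicit Types (a : nat -> T) (f : (nat -> T) -> F).

Lemma act_s i f : (1 <= i <= k - 1)%N ->
  act (pa_s F k i) f = (fun a => f (swap_pos i a)).
Proof.
move=> hi; apply/funext=> a; rewrite act_diagram /diagram_act.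
rewrite (bigD1 (row_of k (swap_pos i a))) //= big1 ?addr0 => [|b]; last first.
  case: row_compatibleP => [h|_] /eqP ne; last by rewrite mul0r.
  case: ne; apply/ffunP=> j; rewrite ffunE /swap_pos.
  have jk := ltn_ord j.
  have lt : ((swap i i.+1 j.+1).-1 < k)%N by rewrite /swap; do ?[case: eqP => ?]; lia.
  have := h (inl (Ordinal lt)) (inr j); rewrite same_block_fibres /= ffunE => <-.
    by congr (a _); rewrite /= /swap; do ?[case: eqP => ?]; lia.
  by rewrite /swap; apply/eqP; do ?[case: eqP => ?]; lia.
case: row_compatibleP => [_|]; last first.
  case=> -[u|u] [v|v]; rewrite same_block_fibres /= !ffunE /swap_pos /swap => /eqP E;
    have := ltn_ord u; have := ltn_ord v => *; congr (a _);
    move: E; do ?[case: eqP => ?]; lia.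
rewrite mul1r; congr f; apply/funext=> -[|j]; rewrite /set_row /swap_pos.
  by rewrite /swap; do ?[case: eqP => ?]; congr (a _); lia.
case: insubP => [u _ uj|]; first by rewrite ffunE uj.
by rewrite -leqNgt /swap => ?; congr (a _); do ?[case: eqP => ?]; lia.
Qed.

Lemma act_e_even i f : (1 <= i <= k - 1)%N ->
  act (pa_e F k (2 * i)) f = (fun a => if a i == a i.+1 then f a else 0).
Proof.
move=> hi; apply/funext=> a; rewrite /pa_e mul2n odd_double doubleK.
rewrite act_diagram /diagram_act.
rewrite (bigD1 (row_of k a)) //= big1 ?addr0 => [|b]; last first.
  case: row_compatibleP => [h|_] /eqP ne; last by rewrite mul0r.
  case: ne; apply/ffunP=> j; rewrite ffunE.
  by have := h (inl j) (inr j); rewrite same_block_fibres /= ffunE => <-.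
rewrite set_row_of; case: row_compatibleP => [h|h].
  have i1 : (i.-1 < k)%N by lia.
  have i2 : (i < k)%N by lia.
  have : a i = a i.+1.
    have := h (inl (Ordinal i1)) (inl (Ordinal i2)).
    rewrite same_block_fibres /= !ffunE /= prednK; last by lia.
    by apply; rewrite eqxx; case: ifP.
  by move/eqP => ->; rewrite mul1r.
case: eqP => [ai|_]; last by rewrite mul0r.
case: h => u v.
have colE (w : vertex k) : row_colour (row_of k a) (row_of k a) w = a (position w).
  by case: w => w; rewrite /= ffunE.
have label w : a (position w) = a (if position w == i.+1 then i else @position k w).
  by case: eqP => // ->.
by rewrite same_block_fibres !colE !label => /eqP ->.
Qed.

Lemma act_e_odd i f : (1 <= i <= k)%N ->
  act (pa_e F k (2 * i - 1)) f = (fun a => \sum_c f (recolour a i c)).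
Proof.
move=> hi; apply/funext=> a; rewrite /pa_e.
have -> : odd (2 * i - 1) by lia.
have -> : (2 * i - 1).+1./2 = i by lia.
rewrite act_diagram /diagram_act.
have lt : (i.-1 < k)%N by lia.
(* Compatible bottom rows agree with [a] except at position i, where the colour is free. *)
rewrite (bigID (fun b => [exists c, b == row_of k (recolour a i c)])) /=.
rewrite [X in _ + X]big1 ?addr0 => [|b /existsPn ne]; last first.
  case: row_compatibleP => [h|_]; last by rewrite mul0r.
  case/eqP: (ne (b (Ordinal lt))); apply/ffunP=> j; rewrite ffunE /recolour.
  case: eqP => [E|ji]; first by congr (b _); apply: val_inj; rewrite /= -E.
  have := h (inl j) (inr j); rewrite same_block_fibres /= ffunE => <- //.
  by rewrite (introF eqP ji).
have oi c : row_of k (recolour a i c) (Ordinal lt) = c.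
  by rewrite ffunE /recolour /= prednK ?eqxx //; lia.
rewrite (reindex_onto (fun c => row_of k (recolour a i c)) (fun b => b (Ordinal lt))) /=.
  apply: eq_big => [c|c _]; first by rewrite oi eqxx andbT; apply/existsP; exists c.
  case: row_compatibleP => [_|]; last first.
    case=> -[u|u] [v|v]; rewrite same_block_fibres /= !ffunE /recolour => /eqP E;
      have := ltn_ord u; have := ltn_ord v => *;
      move: E; do ?[case: eqP => ?] => // E; by [exfalso; lia | congr (a _); lia].
  rewrite mul1r; congr f; apply/funext=> -[|j]; rewrite /set_row /recolour.
    by case: eqP => //; lia.
  case: insubP => [u _ uj|]; first by rewrite ffunE uj.
  by rewrite -leqNgt => ?; case: eqP => // ?; lia.
by move=> b /existsP[c /eqP->]; rewrite oi.
Qed.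

Lemma act_e_odd1 i f : (i < k)%N ->
  act (pa_e F k (2 * i + 1)) f = (fun a => \sum_c f (recolour a i.+1 c)).
Proof.
move=> hi; have -> : (2 * i + 1 = 2 * i.+1 - 1)%N by lia.
exact: act_e_odd.
Qed.

End Generators.

(** * Enyang's elements *)

(** An even [pa_e] after a sum over colours tests two colours for equality, which leaves a single
    summand. *)
Lemma sum_if_eq (V : nmodType) (T : finType) (c : T) (P : pred T) (G : T -> V) :
  (forall b, P b = (b == c)) -> \sum_b (if P b then G b else 0) = G c.
Proof. by move=> h; rewrite -big_mkcond (big_pred1 c). Qed.


(* Tests between positions are decided by [lia], those between colours by
   case analysis. *)
Ltac decide_tests :=
  repeat match goal with
  | |- context[if ?c then _ else _] =>
    lazymatch c with
    | context[if _ then _ else _] => fail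
    | @eq_op ?A ?x ?y =>
      lazymatch eval hnf in (Equality.sort A) with
      | nat => first [ rewrite (_ : c = true); [|lia] | rewrite (_ : c = false); [|lia]
                     | let H := fresh in case: (@eqP A x y) => H ]
      | _ => first [ rewrite (@eqxx A x)
                   | let H := fresh in case: (@eqP A x y) => H; try (exfalso; congruence) ]
      end
    | _ => first [ rewrite (_ : c = true); [|lia] | rewrite (_ : c = false); [|lia]
                 | let H := fresh in destruct c eqn:H ]
    end
  end.


Ltac unfold_moves :=
  rewrite /swap_pos /recolour /act_upto /swap /=.

(** Two colourings can differ at [j] only through the positions named in the goal; branching on
    these first leaves the other position tests to [lia]. *)
Ltac compare_position j :=
  repeat match goal with
  | |- context[?a ?p] =>
    lazymatch type of p with nat => idtac end; is_var a;
    lazymatch goal with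
    | _ : j = p |- _ => fail
    | _ : j <> p |- _ => fail
    | _ => lazymatch p with
           | j => fail
           | context[if _ then _ else _] => fail
           | _ => let H := fresh in
                  case: (@eqP _ j p) => H; try (exfalso; lia)
           end
    end
  end.

Ltac same_colouring :=
  let j := fresh "j" in
  apply/funext=> j; unfold_moves; compare_position j;
  decide_tests; first [done | congruence | congr (_ _); lia].

Ltac same_value :=
  unfold_moves; decide_tests; rewrite ?(subrr, subr0, oppr0, addr0, add0r);
  first [done | exact: eq_sym | by congr (_ == _); congruence
        | by rewrite eq_sym; congr (_ == _); congruence
        | by congr (_ _); same_colouring].

Ltac same_sum :=
  let b := fresh "b" in
  apply: eq_bigr => b; first [move/eqP => ? | move=> _]; same_value.

Ltac pick_sum c :=
  rewrite (@sum_if_eq _ _ c); [ | by move=> ?; same_value].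

Section EnyangElements.

Variables (F : numDomainType) (k : nat) (I : finType).
Local Notation T := {ffun I -> bool}.
Implicit Types (a : nat -> T) (f : (nat -> T) -> F).
Local Notation act := (@act F k I).
Local Notation s := (pa_s F k).
Local Notation e := (pa_e F k).
Local Notation L := (pa_L F k).
Local Notation sg := (pa_sigma F k).

Definition sum_swaps (m i : nat) f a : F :=
  \sum_b f (act_upto m (swap (a i) b) a).

Definition swap_next (m i : nat) f a : F :=
  f (act_upto m (swap (a i) (a i.+1)) a).

(** Conjugation by s_i yields the transpositions (a_(i+1) b) but leaves position i alone. If a_i and
    a_(i+1) differ, this is wrong only for b = a_i: the term s_i L e removes that summand and
    sigma_(2i+1) supplies the right one. If they agree, e L e_(2i+1) e is the whole sum and the
    other terms cancel in pairs. *)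
Lemma act_L_even_step i f : (1 <= i <= k - 1)%N ->
    (forall f, act (L (2 * i)) f = sum_swaps i i f) ->
    (forall f, act (sg (2 * i + 1)) f = swap_next i.+1 i f) ->
  act (L (2 * i + 2)) f = sum_swaps i.+1 i.+1 f.
Proof.
move=> hi hL hsg; rewrite pa_L_evenE; last by lia.
rewrite !(actD, actN, actM) !hL hsg !act_s // !act_e_even // !act_e_odd1; last by lia.
apply/funext=> a; rewrite /sum_swaps /swap_next.
case: (a i =P a i.+1) => xy /=.
  match goal with |- ?A - ?B - ?C + ?D + ?E = ?S =>
    suff [-> -> ->] : [/\ B = E, C = A & D = S] by ring end.
  split; [pick_sum (a i); same_value | same_sum |].
  by apply: eq_bigr => b _; pick_sum b; same_value.
rewrite [in RHS](bigD1 (a i)) // [X in X - _ - _ + _ + _ = _](bigD1 (a i)) //=.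
match goal with |- ?A0 + ?A - ?B - 0 + 0 + ?E = ?S0 + ?S =>
  suff [-> -> ->] : [/\ B = A0, E = S0 & S = A] by ring end.
split; [pick_sum (a i); same_value | same_value | same_sum].
Qed.

(** For distinct a_i and a_(i+1), again only the summand b = a_i notices whether position i is
    included: sigma_(2i) cancels the one from the conjugate, and L_(2i) e_(2i) gives the one
    required. *)
Lemma act_L_odd_step i f : (1 <= i <= k - 1)%N ->
    (forall f, act (L (2 * i)) f = sum_swaps i i f) ->
    (forall f, act (L (2 * i - 1)) f =
       (fun a => #|T|%:R * f a - sum_swaps i.-1 i f a)) ->
    (forall f, act (sg (2 * i)) f = swap_next i.-1 i f) ->
  act (L (2 * i + 1)) f = (fun a => #|T|%:R * f a - sum_swaps i i.+1 f a).
Proof.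
move=> hi hLe hLo hsg; rewrite pa_L_oddE; last by lia.
rewrite !(actD, actN, actM) !hLe !hLo hsg !act_s // !act_e_even // act_z.
apply/funext=> a; rewrite /sum_swaps /swap_next.
have -> : swap_pos i (swap_pos i a) = a by same_colouring.
case: (a i =P a i.+1) => xy /=.
  match goal with |- ?z - ?A - ?B - ?C + (?z1 + - (?z1 - ?D)) + ?E = ?z - ?S =>
    suff [-> -> ->] : [/\ B = E, C = S & A = D] by ring end.
  split; [pick_sum (a i.+1); same_value | same_sum | same_sum].
have -> : \sum_b (if act_upto i.-1 (swap (a i) b) a i ==
     act_upto i.-1 (swap (a i) b) a i.+1
   then f (act_upto i.-1 (swap (a i) b) a) else 0) = 0.
  by apply: big1 => b _; same_value.
rewrite mulr0.
rewrite [X in _ = _ - X](bigD1 (a i)) //.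
rewrite [X in _ - X - _ - _ + _ + _ = _](bigD1 (a i)) //=.
match goal with
  |- ?z - (?A0 + ?A) - ?B - 0 + (0 - (0 - 0)) + ?E = ?z - (?S0 + ?S) =>
  suff [-> -> ->] : [/\ B = S0, E = A0 & S = A] by ring end.
split; [pick_sum (a i.+1); same_value | same_value | same_sum].
Qed.

(** Conjugation by s_(i-1) s_i carries the exchanged pair to positions i, i+1 but leaves out
    position i-1. That matters only if a_(i-1) equals a_i or a_(i+1); the four correction terms are
    supported on these coincidences and replace the wrong value. The odd step follows the same
    pattern. *)
Lemma act_sigma_even_step i f : (2 <= i <= k - 1)%N ->
    (forall f, act (L (2 * i.-1)) f = sum_swaps i.-1 i.-1 f) ->
    (forall f, act (sg (2 * i.-1)) f = swap_next i.-2 i.-1 f) ->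
  act (sg (2 * i)) f = swap_next i.-1 i f.
Proof.
case: i => // j hi hL hsg; rewrite pa_sigma_evenE; last by lia.
rewrite /= in hL hsg.
have -> : (2 * j.+1 - 2 = 2 * j)%N by lia.
have -> : (2 * j.+1 - 1 = 2 * j + 1)%N by lia.
have -> : (j.+1 - 1 = j)%N by lia.
rewrite !(actD, actN, actM) !hL hsg !act_s; try lia.
rewrite !act_e_even ?act_e_odd1; try lia.
apply/funext=> a; rewrite /sum_swaps /swap_next.
have -> : swap_pos j.+1 a j = a j by same_value.
have -> : swap_pos j.+1 a j.+1 = a j.+2 by same_value.
case: (a j =P a j.+1) => xy; case: (a j =P a j.+2) => xw.
- pick_sum (a j.+2); pick_sum (a j.+1); pick_sum (a j.+2); pick_sum (a j.+1).
  pick_sum (a j.+1); pick_sum (a j).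
  match goal with |- ?M + ?A + ?B - ?C - ?D = ?S =>
    suff [-> -> -> ->] : [/\ A = S, B = S, C = S & D = M] by ring end.
  by split; same_value.
- pick_sum (a j.+2); pick_sum (a j.+2); pick_sum (a j).
  match goal with |- ?M + ?A + 0 - ?C - 0 = ?S =>
    suff [-> ->] : A = S /\ C = M by ring end.
  by split; same_value.
- pick_sum (a j.+1); pick_sum (a j.+1); pick_sum (a j).
  match goal with |- ?M + 0 + ?B - 0 - ?D = ?S =>
    suff [-> ->] : B = S /\ D = M by ring end.
  by split; same_value.
by rewrite !addr0 !subr0; same_value.
Qed.

Lemma act_sigma_odd_step i f : (2 <= i <= k - 1)%N ->
    (forall f, act (L (2 * i.-1)) f = sum_swaps i.-1 i.-1 f) ->
    (forall f, act (sg (2 * i.-1 + 1)) f = swap_next i i.-1 f) ->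
  act (sg (2 * i + 1)) f = swap_next i.+1 i f.
Proof.
case: i => // j hi hL hsg; rewrite pa_sigma_oddE; last by lia.
rewrite /= in hL hsg.
have -> : (2 * j.+1 - 2 = 2 * j)%N by lia.
have -> : (2 * j.+1 - 1 = 2 * j + 1)%N by lia.
have -> : (j.+1 - 1 = j)%N by lia.
rewrite !(actD, actN, actM) !hL hsg !act_s; try lia.
rewrite !act_e_even ?act_e_odd1; try lia.
apply/funext=> a; rewrite /sum_swaps /swap_next.
have -> : swap_pos j.+1 a j = a j by same_value.
have -> : swap_pos j.+1 a j.+1 = a j.+2 by same_value.
case: (a j =P a j.+1) => xy; case: (a j =P a j.+2) => xw.
- pick_sum (a j.+1); pick_sum (a j.+2); pick_sum (a j.+1); pick_sum (a j).
  pick_sum (a j.+2); pick_sum (a j).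
  match goal with |- ?M + ?A + ?B - ?C - ?D = ?S =>
    suff [-> -> -> ->] : [/\ A = S, B = S, C = S & D = M] by ring end.
  by split; same_value.
- pick_sum (a j.+2). pick_sum (a j.+2). pick_sum (a j).
  match goal with |- ?M + 0 + ?B - 0 - ?C = ?S =>
    suff [-> ->] : B = S /\ C = M by ring end.
  by split; same_value.
- pick_sum (a j.+1). pick_sum (a j.+1). pick_sum (a j).
  match goal with |- ?M + ?B + 0 - ?D - 0 = ?S =>
    suff [-> ->] : B = S /\ D = M by ring end.
  by split; same_value.
by rewrite !addr0 !subr0; same_value.
Qed.

(** The recursions are mutual, so the four formulas are proved together. Those for sigma stop at i <
    k because they involve position i+1. *)
Lemma act_L_sigma i : (1 <= i <= k)%N ->
  [/\ forall f, act (L (2 * i)) f = sum_swaps i i f,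
      forall f, act (L (2 * i - 1)) f =
        (fun a => #|T|%:R * f a - sum_swaps i.-1 i f a),
      (i < k)%N -> forall f, act (sg (2 * i)) f = swap_next i.-1 i f
    & (i < k)%N -> forall f, act (sg (2 * i + 1)) f = swap_next i.+1 i f].
Proof.
elim: i => // -[|i] IH hi.
  split=> [f|f|hk f|hk f].
  - rewrite (pa_L_double F k 1) -[L_even _ _ _]/(e (2 * 1 - 1)) act_e_odd //.
    by apply/funext=> a; same_sum.
  (* On the empty prefix every transposition is trivial, so the sum is z times [f] and the
     difference is L_1 = 0. *)
  - rewrite /= (pa_L_double1 F k 0) act0; apply/funext=> a.
    rewrite /sum_swaps (eq_bigr (fun=> f a)) => [|b _]; last by same_value.
    by rewrite sumr_const mulr_natl; apply/esym/subrr.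
  - by rewrite pa_sigma_double act1; apply/funext=> a; same_value.
  - rewrite pa_sigma_double1 -[sigma_odd _ _ _]/(s 1) act_s; last by lia.
    by apply/funext=> a; same_value.
have [|hLe hLo hse hso] := IH; first by lia.
have {}hse := hse hi; have {}hso := hso hi.
split=> [f|f|hk f|hk f].
- have -> : (2 * i.+2 = 2 * i.+1 + 2)%N by lia.
  by apply: act_L_even_step => //; lia.
- have -> : (2 * i.+2 - 1 = 2 * i.+1 + 1)%N by lia.
  by apply: act_L_odd_step => //; lia.
- by apply: act_sigma_even_step => //; lia.
- by apply: act_sigma_odd_step => //; lia.
Qed.

End EnyangElements.

(** * Conjugating transpositions of colours; the action of t and X *)

Section Swap.
Variable T : eqType.
Implicit Types x y c : T.

Lemma swapK x y : involutive (swap x y).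
Proof. by move=> c; rewrite /swap; decide_tests; congruence. Qed.

Lemma swap_inj x y : injective (swap x y).
Proof. exact: inv_inj (swapK x y). Qed.

Lemma swap_conj (p : T -> T) x y c : injective p ->
  swap (p x) (p y) (p c) = p (swap x y c).
Proof. by move=> hp; rewrite /swap !(inj_eq hp); decide_tests; congruence. Qed.

End Swap.

(** The source of the commutation relations between t and x: a permutation on a longer prefix passes
    a transposition on a shorter one, relabelling its two colours. *)
Lemma act_upto_conj (T : eqType) (m n : nat) (p : T -> T) x y (a : nat -> T) :
    injective p -> (m <= n)%N ->
  act_upto m (swap (p x) (p y)) (act_upto n p a)
    = act_upto n p (act_upto m (swap x y) a).
Proof.
move=> hp mn; apply/funext=> j; rewrite /act_upto.
case: ifP => [jm|//]; have -> : (0 < j <= n)%N by lia.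
exact: swap_conj.
Qed.

(** The longer prefix [n] contains i and i+1, so the second move relabels both colours of the first;
    the first move does not reach j. All parities in the commutation of two t's are instances. *)
Lemma swap_next_comm (T : eqType) (V : nmodType) (f : (nat -> T) -> V)
    (m n i j : nat) (a : nat -> T)
    (b := act_upto m (swap (a i) (a i.+1)) a)
    (c := act_upto n (swap (a j) (a j.+1)) a) :
    (0 < i < n)%N -> (m < j)%N -> (m <= n)%N ->
  (if a i == a i.+1 then 0 else if b j == b j.+1 then 0
   else f (act_upto n (swap (b j) (b j.+1)) b))
  = (if a j == a j.+1 then 0 else if c i == c i.+1 then 0
     else f (act_upto m (swap (c i) (c i.+1)) c)).
Proof.
move=> hi mj mn.
have bE l : (m < l)%N -> b l = a l by move=> ml; rewrite /b /act_upto ifF //; lia.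
have cE l : (0 < l <= n)%N -> c l = swap (a j) (a j.+1) (a l).
  by move=> hl; rewrite /c /act_upto hl.
rewrite !bE ?cE; try lia.
rewrite (inj_eq (@swap_inj _ _ _)) act_upto_conj //; last exact: swap_inj.
by case: ifP => _; case: ifP.
Qed.

Lemma sum_swap (V : nmodType) (T : finType) (x y : T) (G : T -> V) :
  \sum_c G c = \sum_c G (swap x y c).
Proof. exact: reindex_inj (@swap_inj _ x y). Qed.

Section ActionXT.

Variables (F : numDomainType) (k : nat) (I : finType).
Local Notation T := {ffun I -> bool}.
Implicit Types (a : nat -> T) (f : (nat -> T) -> F).
Local Notation act := (@act F k I).

(** Where a_i = a_(i+1), sigma is the identity, and e_(2i) is the projection onto that case;
    subtracting it cuts sigma off there. *)
Lemma act_t_even i f : (1 <= i <= k - 1)%N -> act (pa_t F k (2 * i)) f =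
  (fun a => if a i == a i.+1 then 0
            else f (act_upto i.-1 (swap (a i) (a i.+1)) a)).
Proof.
move=> hi; rewrite /pa_t actD actN.
have -> : ((2 * i)./2 = i)%N by lia.
have [|_ _ hs _] := @act_L_sigma F k I i; first by lia.
rewrite hs ?act_e_even //; last by lia.
apply/funext=> a; rewrite /swap_next; case: (a i =P a i.+1) => [<-|_]; last exact: subr0.
by apply/eqP; rewrite subr_eq0; apply/eqP; same_value.
Qed.

Lemma act_t_odd i f : (1 <= i <= k - 1)%N -> act (pa_t F k (2 * i + 1)) f =
  (fun a => if a i == a i.+1 then 0
            else f (act_upto i.+1 (swap (a i) (a i.+1)) a)).
Proof.
move=> hi; rewrite /pa_t actD actN.
have -> : ((2 * i + 1)./2 = i)%N by lia.
have [|_ _ _ hs] := @act_L_sigma F k I i; first by lia.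
rewrite hs ?act_e_even //; last by lia.
apply/funext=> a; rewrite /swap_next; case: (a i =P a i.+1) => [<-|_]; last exact: subr0.
by apply/eqP; rewrite subr_eq0; apply/eqP; same_value.
Qed.

(** With z the number of colours, the opposite signs in the definition of X give one formula for
    both parities. *)
Lemma act_X r f : (1 <= r <= 2 * k)%N -> act (pa_X F k r) f =
  (fun a => sum_swaps r./2 r.+1./2 f a - f a).
Proof.
move=> hr; have [|hLe hLo _ _] := @act_L_sigma F k I r.+1./2; first by lia.
apply/funext=> a; rewrite /pa_X; case: ifP => odd_r.
  have -> : (r./2 = r.+1./2.-1)%N by lia.
  have {1}-> : (r = 2 * r.+1./2 - 1)%N by lia.
  by rewrite !(actD, actN) hLo act1 act_z; ring.
have {1 2}-> : (r = 2 * r.+1./2)%N by lia.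
have -> : (2 * r.+1./2)./2 = r.+1./2 by lia.
by rewrite !(actD, actN) hLe act1.
Qed.

Lemma act_X_even i f : (1 <= i <= k)%N ->
  act (pa_X F k (2 * i)) f = (fun a => sum_swaps i i f a - f a).
Proof.
move=> hi; rewrite act_X; last by lia.
have -> : ((2 * i)./2 = i)%N by lia.
by have -> : ((2 * i).+1./2 = i)%N by lia.
Qed.

Lemma act_X_odd i f : (1 <= i <= k)%N ->
  act (pa_X F k (2 * i - 1)) f = (fun a => sum_swaps i.-1 i f a - f a).
Proof.
move=> hi; rewrite act_X; last by lia.
have -> : ((2 * i - 1)./2 = i.-1)%N by lia.
by have -> : ((2 * i - 1).+1./2 = i)%N by lia.
Qed.

Lemma act_X_odd1 i f : (i < k)%N ->
  act (pa_X F k (2 * i + 1)) f = (fun a => sum_swaps i i.+1 f a - f a).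
Proof.
move=> hi; rewrite act_X; last by lia.
have -> : ((2 * i + 1)./2 = i)%N by lia.
by have -> : ((2 * i + 1).+1./2 = i.+1)%N by lia.
Qed.

Lemma act_scale u c f : act u (fun a => c * f a) = (fun a => c * act u f a).
Proof.
apply/funext=> a; rewrite /act /diagram_act mulr_sumr; apply: eq_bigr => d _.
rewrite mulrCA; congr (_ * _); rewrite mulr_sumr.
by apply: eq_bigr => b _; rewrite mulrCA.
Qed.

End ActionXT.

(** Faithfulness turns an identity of elements into one of explicit sums at a generic colouring. The
    forms of [act_X] for a given parity come before the general one, which would match them all. *)
Ltac act_norm :=
  apply: act_faithful => I f;
  rewrite ?expr2 /aff_s;
  repeat first
    [ rewrite act_t_even; [|lia] | rewrite act_t_odd; [|lia]
    | rewrite act_e_even; [|lia] | rewrite act_e_odd1; [|lia]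
    | rewrite act_e_odd; [|lia] | rewrite act_s; [|lia]
    | rewrite act_X_odd1; [|lia] | rewrite act_X_odd; [|lia]
    | rewrite act_X_even; [|lia] | rewrite act_X; [|lia]
    | rewrite act_z | rewrite act1 | rewrite act0
    | rewrite actM | rewrite actD | rewrite actN ];
  let a := fresh "a" in apply/funext=> a; cbv beta.

(** * The defining relations *)

Section Relations.
Variables (F : numDomainType) (k : nat).
Local Notation t := (pa_t F k).
Local Notation e := (pa_e F k).
Local Notation x := (pa_X F k).
Local Notation s := (pa_s F k).


Lemma pa_t_even_sq i : (1 <= i <= k - 1)%N -> t (2 * i) ^+ 2 = 1 - e (2 * i).
Proof.
move=> hi; act_norm; case: (a i =P a i.+1) => xy; first by rewrite subrr.
by rewrite subr0; same_value.
Qed.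

Lemma pa_t_odd_sq i : (1 <= i <= k - 1)%N -> t (2 * i + 1) ^+ 2 = 1 - e (2 * i).
Proof.
move=> hi; act_norm; case: (a i =P a i.+1) => xy; first by rewrite subrr.
by rewrite subr0; same_value.
Qed.

Lemma pa_s_tau i : (1 <= i <= k - 1)%N ->
  t (2 * i) * t (2 * i + 1) + e (2 * i) = s i.
Proof.
move=> hi; act_norm; case: (a i =P a i.+1) => xy.
  by rewrite add0r; same_value.
by rewrite addr0; same_value.
Qed.

Lemma pa_s_braid i : (1 <= i <= k - 2)%N ->
  s i * s (i + 1) * s i = s (i + 1) * s i * s (i + 1).
Proof. by move=> hi; rewrite addn1; act_norm; same_value. Qed.

Lemma pa_e_even_sq i : (1 <= i <= k - 1)%N -> e (2 * i) ^+ 2 = e (2 * i).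
Proof. by move=> hi; act_norm; same_value. Qed.

Lemma pa_t_odd_e i : (1 <= i <= k - 1)%N -> t (2 * i + 1) * e (2 * i) = 0.
Proof. by move=> hi; act_norm; same_value. Qed.

Lemma pa_e_t_odd i : (1 <= i <= k - 1)%N -> e (2 * i) * t (2 * i + 1) = 0.
Proof. by move=> hi; act_norm; same_value. Qed.

Lemma pa_t_even_e i : (1 <= i <= k - 1)%N -> t (2 * i) * e (2 * i) = 0.
Proof. by move=> hi; act_norm; same_value. Qed.

Lemma pa_e_t_even i : (1 <= i <= k - 1)%N -> e (2 * i) * t (2 * i) = 0.
Proof. by move=> hi; act_norm; same_value. Qed.

Lemma pa_t_odd_e_even i j : (1 <= i <= k - 1)%N -> (1 <= j <= k - 1)%N ->
  j <> i.+1 -> t (2 * i + 1) * e (2 * j) = e (2 * j) * t (2 * i + 1).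
Proof. by move=> hi hj ij; act_norm; same_value. Qed.

Lemma pa_t_even_e_even i j : (1 <= i <= k - 1)%N -> (1 <= j <= k - 1)%N ->
  i <> j.+1 -> t (2 * i) * e (2 * j) = e (2 * j) * t (2 * i).
Proof. by move=> hi hj ij; act_norm; same_value. Qed.

Lemma pa_t_e_even_t i : (1 <= i <= k - 2)%N ->
  t (2 * i.+1) * e (2 * i) * t (2 * i.+1)
    = t (2 * i + 1) * e (2 * i.+1) * t (2 * i + 1).
Proof. by move=> hi; act_norm; same_value. Qed.

Lemma pa_t_braid_even i : (1 <= i <= k - 2)%N ->
  t (2 * i) * t (2 * i.+1) * t (2 * i)
    = t (2 * i.+1) * t (2 * i) * t (2 * i.+1) * (1 - e (2 * i)).
Proof. by move=> hi; act_norm; same_value. Qed.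

Lemma pa_t_braid_odd i : (1 <= i <= k - 2)%N ->
  t (2 * i.+1 + 1) * t (2 * i + 1) * t (2 * i.+1 + 1)
    = t (2 * i + 1) * t (2 * i.+1 + 1) * t (2 * i + 1) * (1 - e (2 * i.+1)).
Proof. move=> hi; act_norm; same_value. Qed.

Lemma pa_t_odd_even_odd i : (1 <= i <= k - 2)%N ->
  t (2 * i + 1) * t (2 * i.+1) * t (2 * i + 1)
    = t (2 * i.+1) - e (2 * i) * t (2 * i.+1) - t (2 * i.+1) * e (2 * i).
Proof.  move=> hi; act_norm; same_value. Qed.

Lemma pa_t_even_odd_even i : (1 <= i <= k - 2)%N ->
  t (2 * i.+1) * t (2 * i + 1) * t (2 * i.+1)
    = t (2 * i + 1) - e (2 * i.+1) * t (2 * i + 1) - t (2 * i + 1) * e (2 * i.+1).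
Proof. move=> hi; act_norm; same_value. Qed.

Lemma pa_t_odd_even i j : (1 <= i <= k - 1)%N -> (1 <= j <= k - 1)%N ->
  j <> i.+1 -> t (2 * i + 1) * t (2 * j) = t (2 * j) * t (2 * i + 1).
Proof.
move=> hi hj ij; act_norm; case: (leqP j i) => ji.
  by apply/esym/swap_next_comm; lia.
by apply: swap_next_comm; lia.
Qed.

Lemma pa_t_even_even i j : (1 <= i <= k - 1)%N -> (1 <= j <= k - 1)%N ->
  i <> j.+1 -> j <> i.+1 -> t (2 * i) * t (2 * j) = t (2 * j) * t (2 * i).
Proof.
move=> hi hj ij ji; case: (ltngtP i j) => [lt|lt|-> //]; act_norm.
  by apply: swap_next_comm; lia.
by apply/esym/swap_next_comm; lia.
Qed.

Lemma pa_t_odd_odd i j : (1 <= i <= k - 1)%N -> (1 <= j <= k - 1)%N ->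
  i <> j.+1 -> j <> i.+1 ->
  t (2 * i + 1) * t (2 * j + 1) = t (2 * j + 1) * t (2 * i + 1).
Proof.
move=> hi hj ij ji; case: (ltngtP i j) => [lt|lt|-> //]; act_norm.
  by apply: swap_next_comm; lia.
by apply/esym/swap_next_comm; lia.
Qed.

Lemma pa_e_odd_sq i : (1 <= i <= k)%N ->
  e (2 * i - 1) ^+ 2 = pa_z F k * e (2 * i - 1).
Proof.
move=> hi; act_norm; rewrite mulr_natl -sumr_const.
by apply: eq_bigr => c _; same_sum.
Qed.

Lemma pa_t_ee i : (1 <= i <= k - 1)%N ->
  t (2 * i) * e (2 * i - 1) * e (2 * i + 1)
    = t (2 * i + 1) * e (2 * i - 1) * e (2 * i + 1).
Proof.
move=> hi; act_norm; case: (a i =P a i.+1) => xy //.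
by apply: eq_bigr => c _; same_sum.
Qed.

Lemma pa_ee_t i : (1 <= i <= k - 1)%N ->
  e (2 * i + 1) * e (2 * i - 1) * t (2 * i)
    = e (2 * i + 1) * e (2 * i - 1) * t (2 * i + 1).
Proof.
move=> hi; act_norm; rewrite exchange_big.
by apply: eq_bigr => c _; same_sum.
Qed.

Lemma pa_e_odd_e_odd i j : (1 <= i <= k)%N -> (1 <= j <= k)%N ->
  i <> j -> e (2 * i - 1) * e (2 * j - 1) = e (2 * j - 1) * e (2 * i - 1).
Proof.
move=> hi hj ij; act_norm; rewrite exchange_big.
by apply: eq_bigr => c _; same_sum.
Qed.

Lemma pa_e_even_e_even i j : (1 <= i <= k - 1)%N -> (1 <= j <= k - 1)%N ->
  e (2 * i) * e (2 * j) = e (2 * j) * e (2 * i).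
Proof. by move=> hi hj; act_norm; same_value. Qed.

Lemma pa_e_even_e_odd i j : (1 <= i <= k - 1)%N -> (1 <= j <= k)%N ->
  j <> i -> j <> i.+1 -> e (2 * i) * e (2 * j - 1) = e (2 * j - 1) * e (2 * i).
Proof.
move=> hi hj ji ji1; act_norm; case: (a i =P a i.+1) => xy; first same_sum.
by apply/esym/big1 => c _; same_value.
Qed.

Lemma pa_t_odd_e_odd i j : (1 <= i <= k - 1)%N -> (1 <= j <= k)%N ->
  j <> i -> j <> i.+1 ->
  t (2 * i + 1) * e (2 * j - 1) = e (2 * j - 1) * t (2 * i + 1).
Proof.
move=> hi hj ji ji1; act_norm; case: (a i =P a i.+1) => xy.
  by apply/esym/big1 => c _; same_value.
case: (ltnP j i) => hij; last same_sum.
(* Position j lies in the prefix of t, which therefore also permutes the new colour. *)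
rewrite (sum_swap (a i) (a i.+1)); same_sum.
Qed.

Lemma pa_t_even_e_odd i j : (1 <= i <= k - 1)%N -> (1 <= j <= k)%N ->
  j <> i -> j <> i.+1 ->
  t (2 * i) * e (2 * j - 1) = e (2 * j - 1) * t (2 * i).
Proof.
move=> hi hj ji ji1; act_norm; case: (a i =P a i.+1) => xy.
  by apply/esym/big1 => c _; same_value.
case: (ltnP j i) => hij; last same_sum.
rewrite (sum_swap (a i) (a i.+1)); same_sum.
Qed.

Lemma pa_eee_up_odd i : (1 <= i <= k - 1)%N ->
  e (2 * i - 1) * e (2 * i) * e (2 * i - 1) = e (2 * i - 1).
Proof. by move=> hi; act_norm; pick_sum (a i.+1); same_sum. Qed.

Lemma pa_eee_down_odd i : (1 <= i <= k - 1)%N ->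
  e (2 * i) * e (2 * i - 1) * e (2 * i) = e (2 * i).
Proof.
move=> hi; act_norm; case: (a i =P a i.+1) => xy //.
by pick_sum (a i.+1); same_value.
Qed.

Lemma pa_eee_up_even i : (1 <= i <= k - 1)%N ->
  e (2 * i) * e (2 * i + 1) * e (2 * i) = e (2 * i).
Proof.
move=> hi; act_norm; case: (a i =P a i.+1) => xy //.
by pick_sum (a i); same_value.
Qed.

Lemma pa_eee_down_even i : (1 <= i <= k - 1)%N ->
  e (2 * i + 1) * e (2 * i) * e (2 * i + 1) = e (2 * i + 1).
Proof. by move=> hi; act_norm; pick_sum (a i); same_sum. Qed.

Lemma pa_t_e_odd_t i : (1 <= i <= k - 1)%N ->
  t (2 * i) * e (2 * i - 1) * t (2 * i)
    = t (2 * i + 1) * e (2 * i + 1) * t (2 * i + 1).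
Proof.
move=> hi; act_norm; case: (a i =P a i.+1) => xy //.
same_sum.
Qed.

Lemma pa_z_central l (u : partition_algebra F k) :
  pa_z F k * (pa_z F k - 1) ^+ l * u = u * (pa_z F k * (pa_z F k - 1) ^+ l).
Proof.
have zC v : pa_z F k * v = v * pa_z F k.
  by apply: act_faithful => I f; rewrite !actM !act_z act_scale.
suff /commr_sym h : GRing.comm u (pa_z F k * (pa_z F k - 1) ^+ l) by exact: h.
by apply: commrM; [|apply/commrX/commrB; [|exact: commr1]]; exact/esym/zC.
Qed.

(** This is where the image of z_l comes from: L_1 = 0 makes X_1 the central element z - 1, and e_1
    squared contributes one more z. *)
Lemma pa_e_xl_e l : (1 <= k)%N ->
  e 1 * x 1 ^+ l * e 1 = pa_z F k * (pa_z F k - 1) ^+ l * e 1.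
Proof.
move=> hk; have -> : x 1 = pa_z F k - 1 by rewrite /pa_X /pa_L /= subr0.
have ee : e 1 * e 1 = pa_z F k * e 1 by exact: (@pa_e_odd_sq 1 hk).
have zC : GRing.comm (pa_z F k) (pa_z F k - 1) by apply: commrB; [|exact: commr1].
rewrite (_ : e 1 * _ = (pa_z F k - 1) ^+ l * e 1); last first.
  apply/commrX/commrB; last exact: commr1.
  by have := pa_z_central 0 (e 1); rewrite expr0 mulr1.
by rewrite -mulrA ee mulrA (commrX l zC).
Qed.

(** If a_i and a_(i+1) differ, conjugation by t turns (a_i b) into (a_(i+1) b) after relabelling b;
    the summand b = a_i is then corrected at position i by the last two terms. If they agree, e_(2i)
    e_(2i-1) t_(2i) gives the summands with b distinct from a_(i+1), and the remaining one is the
    identity, cancelled by the -1 in X. *)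
Lemma pa_x_odd_next i : (1 <= i <= k - 1)%N ->
  x (2 * i + 1) = t (2 * i) * x (2 * i - 1) * t (2 * i)
    + e (2 * i) * e (2 * i - 1) * t (2 * i)
    + t (2 * i) * e (2 * i - 1) * e (2 * i) - t (2 * i).
Proof.
move=> hi; act_norm; rewrite /sum_swaps; case: (a i =P a i.+1) => xy.
  rewrite (bigD1 (a i.+1)) // [in RHS](bigD1 (a i.+1)) //=.
  match goal with |- ?L0 + ?L - ?f = 0 + (?R0 + ?R) + 0 - 0 =>
    suff [-> -> ->] : [/\ L0 = f, R0 = 0 & R = L] by ring end.
  by split; [same_value | same_value | same_sum].
rewrite [X in _ = X - _ + _ + _ - _](sum_swap (a i) (a i.+1)).
rewrite (bigD1 (a i)) // [X in _ = X - _ + _ + _ - _](bigD1 (a i)) //=.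
match goal with |- ?L0 + ?L - ?f = ?T0 + ?T - ?f' + 0 + ?E - ?D =>
  suff [-> -> -> ->] : [/\ T0 = D, f' = f, E = L0 & T = L] by ring end.
by split; [same_value | same_value | pick_sum (a i.+1); same_value | same_sum].
Qed.

Lemma pa_x_even_next i : (1 <= i <= k - 1)%N ->
  x (2 * i + 2) = t (2 * i + 1) * x (2 * i) * t (2 * i + 1)
    + e (2 * i) * e (2 * i + 1) * t (2 * i + 1) * e (2 * i + 1) * e (2 * i)
    + t (2 * i + 1).
Proof.
move=> hi; have -> : (2 * i + 2 = 2 * i.+1)%N by lia.
act_norm; rewrite /sum_swaps; case: (a i =P a i.+1) => xy.
  rewrite (bigD1 (a i.+1)) // [in RHS](bigD1 (a i.+1)) //=.
  match goal with |- ?L0 + ?L - ?f = 0 + (?R0 + ?R) + 0 =>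
    suff [-> -> ->] : [/\ L0 = f, R0 = 0 & R = L] by ring end.
  split; [same_value | same_value | ].
  (* t moves the new colour [c] to position i, and the final e_(2i) forces the second new colour to
     be [c] as well. *)
  by apply: eq_bigr => c /eqP nc; pick_sum c; same_value.
rewrite (bigD1 (a i)) // [X in _ = X - _ + _ + _](bigD1 (a i)) //=.
match goal with |- ?L0 + ?L - ?f = ?T0 + ?T - ?f' + 0 + ?D =>
  suff [-> -> -> ->] : [/\ T0 = 0, f' = f, D = L0 & T = L] by ring end.
by split; [same_value | same_value | same_value | same_sum].
Qed.

Lemma pa_x_even i : (1 <= i <= k - 1)%N ->
  x (2 * i) = t (2 * i) * x (2 * i) * t (2 * i)
    + e (2 * i) * e (2 * i - 1) * t (2 * i)
    + t (2 * i) * e (2 * i - 1) * e (2 * i).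
Proof.
move=> hi; act_norm; rewrite /sum_swaps; case: (a i =P a i.+1) => xy.
  rewrite (bigD1 (a i.+1)) // [in RHS](bigD1 (a i.+1)) //=.
  match goal with |- ?L0 + ?L - ?f = 0 + (?R0 + ?R) + 0 =>
    suff [-> -> ->] : [/\ L0 = f, R0 = 0 & R = L] by ring end.
  by split; [same_value | same_value | same_sum].
rewrite (bigD1 (a i.+1)) // [X in _ = X - _ + _ + _](bigD1 (a i.+1)) //=.
match goal with |- ?L0 + ?L - ?f = ?T0 + ?T - ?f' + 0 + ?E =>
  suff [-> -> -> ->] : [/\ T0 = 0, f' = f, E = L0 & T = L] by ring end.
by split; [same_value | same_value | pick_sum (a i.+1); same_value | same_sum].
Qed.

Lemma pa_x_odd i : (1 <= i <= k - 1)%N ->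
  x (2 * i + 1) = t (2 * i + 1) * x (2 * i + 1) * t (2 * i + 1)
    + e (2 * i) * e (2 * i + 1) * t (2 * i + 1)
    + t (2 * i + 1) * e (2 * i + 1) * e (2 * i).
Proof.
move=> hi; act_norm; rewrite /sum_swaps; case: (a i =P a i.+1) => xy.
  rewrite (bigD1 (a i.+1)) // [in RHS](bigD1 (a i.+1)) //=.
  match goal with |- ?L0 + ?L - ?f = 0 + (?R0 + ?R) + 0 =>
    suff [-> -> ->] : [/\ L0 = f, R0 = 0 & R = L] by ring end.
  by split; [same_value | same_value | same_sum].
rewrite [X in _ = X - _ + _ + _](sum_swap (a i) (a i.+1)).
rewrite (bigD1 (a i)) // [X in _ = X - _ + _ + _](bigD1 (a i)) //=.
match goal with |- ?L0 + ?L - ?f = ?T0 + ?T - ?f' + 0 + ?E =>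
  suff [-> -> -> ->] : [/\ T0 = 0, f' = f, E = L0 & T = L] by ring end.
by split; [same_value | same_value | pick_sum (a i.+1); same_value | same_sum].
Qed.

Lemma pa_e_odd_xx i : (1 <= i <= k)%N ->
  e (2 * i - 1) * (x (2 * i - 1) - x (2 * i)) = 0.
Proof.
move=> hi; act_norm.
transitivity (\sum_c (sum_swaps i.-1 i f (recolour a i c)
                      - sum_swaps i i f (recolour a i c))).
  by apply: eq_bigr => c _; ring.
(* The transposition (c b) is symmetric, and position i ends with c in one sum and with b in the
   other. *)
apply/eqP; rewrite sumrB /sum_swaps exchange_big subr_eq0; apply/eqP.
by apply: eq_bigr => b _; same_sum.
Qed.

Lemma pa_xx_e_odd i : (1 <= i <= k)%N ->
  (x (2 * i - 1) - x (2 * i)) * e (2 * i - 1) = 0.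
Proof.
move=> hi; act_norm; rewrite /sum_swaps.
match goal with |- ?A - ?C - (?B - ?C) = 0 => suff -> : A = B by ring end.
by apply: eq_bigr => b _; same_sum.
Qed.

Lemma pa_e_even_xx i : (1 <= i <= k - 1)%N ->
  e (2 * i) * (x (2 * i) - x (2 * i + 1)) = 0.
Proof.
move=> hi; act_norm; case: (a i =P a i.+1) => xy //; rewrite /sum_swaps.
match goal with |- ?A - ?C - (?B - ?C) = 0 => suff -> : A = B by ring end.
same_sum.
Qed.

Lemma pa_xx_e_even i : (1 <= i <= k - 1)%N ->
  (x (2 * i) - x (2 * i + 1)) * e (2 * i) = 0.
Proof.
move=> hi; act_norm; rewrite /sum_swaps; pick_sum (a i.+1).
(* Position i receives the image of a_i under (a_(i+1) b), which is a_(i+1) exactly for b = a_i,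
   also when the two colours agree. *)
rewrite (@sum_if_eq _ _ (a i)) => [|b]; last first.
  rewrite /act_upto leqnn ltnn andbF ifT /swap; last by lia.
  case: (a i =P a i.+1) => [->|/eqP/negbTE xy] //.
  by case: (a i =P b) => [->|/eqP]; rewrite ?eqxx // xy [b == _]eq_sym => /negbTE.
match goal with |- ?A - ?C - (?B - ?C) = 0 => suff -> : A = B by ring end.
same_value.
Qed.

(** For i < j the transposition of x_j acts on every colour that x_i uses, so it only relabels the
    summation colour of x_i. *)
Lemma pa_x_x i j : (1 <= i <= 2 * k)%N -> (1 <= j <= 2 * k)%N ->
  x i * x j = x j * x i.
Proof.
wlog ij : i j / (i < j)%N => [hw hi hj|hi hj].
  by case: (ltngtP i j) => [ij|ji|->] //; [apply: hw | apply/esym/hw].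
act_norm; rewrite /sum_swaps !sumrB.
have exchange (A B C D : F) : A - B - (C - D) = A - C - (B - D) by ring.
rewrite exchange; congr (_ - _ - (_ - _)).
rewrite exchange_big; apply: eq_bigr => b _.
rewrite [RHS](sum_swap (a j.+1./2) b); apply: eq_bigr => c _; congr f.
have -> : act_upto i./2 (swap (a i.+1./2) c) a j.+1./2 = a j.+1./2.
  by rewrite /act_upto; case: ifP => //; lia.
have -> : act_upto j./2 (swap (a j.+1./2) b) a i.+1./2
    = swap (a j.+1./2) b (a i.+1./2).
  by rewrite /act_upto ifT //; lia.
by rewrite act_upto_conj //; [exact: swap_inj | lia].
Qed.

(** The prefix of x_j contains positions i and i+1, so its transposition relabels both colours
    exchanged by t. In the low case the prefix of t is the longer one and the roles are reversed;
    the excluded indices lie in between. *)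
Lemma pa_t_even_x_high i j : (1 <= i <= k - 1)%N -> (2 * i + 2 <= j <= 2 * k)%N ->
  t (2 * i) * x j = x j * t (2 * i).
Proof.
move=> hi hj; act_norm; rewrite /sum_swaps; case: (a i =P a i.+1) => xy.
  by rewrite subr0 big1 // => b _; same_value.
congr (_ - _); apply: eq_bigr => b _.
have -> : act_upto i.-1 (swap (a i) (a i.+1)) a j.+1./2 = a j.+1./2.
  by rewrite /act_upto ifF //; lia.
have hq n : (0 < n <= i.+1)%N ->
    act_upto j./2 (swap (a j.+1./2) b) a n = swap (a j.+1./2) b (a n).
  by move=> hn; rewrite /act_upto ifT //; lia.
rewrite !hq; try lia.
by rewrite (inj_eq (@swap_inj _ _ _)) (introF eqP xy) act_upto_conj //;
  [exact: swap_inj | lia].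
Qed.

Lemma pa_t_odd_x_high i j : (1 <= i <= k - 1)%N -> (2 * i + 3 <= j <= 2 * k)%N ->
  t (2 * i + 1) * x j = x j * t (2 * i + 1).
Proof.
move=> hi hj; act_norm; rewrite /sum_swaps; case: (a i =P a i.+1) => xy.
  by rewrite subr0 big1 // => b _; same_value.
congr (_ - _); apply: eq_bigr => b _.
have -> : act_upto i.+1 (swap (a i) (a i.+1)) a j.+1./2 = a j.+1./2.
  by rewrite /act_upto ifF //; lia.
have hq n : (0 < n <= i.+1)%N ->
    act_upto j./2 (swap (a j.+1./2) b) a n = swap (a j.+1./2) b (a n).
  by move=> hn; rewrite /act_upto ifT //; lia.
rewrite !hq; try lia.
by rewrite (inj_eq (@swap_inj _ _ _)) (introF eqP xy) act_upto_conj //;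
  [exact: swap_inj | lia].
Qed.

Lemma pa_t_even_x_low i j : (1 <= i <= k - 1)%N -> (1 <= j <= 2 * i - 2)%N ->
  t (2 * i) * x j = x j * t (2 * i).
Proof.
move=> hi hj; act_norm; rewrite /sum_swaps.
have hq b n : (i <= n)%N -> act_upto j./2 (swap (a j.+1./2) b) a n = a n.
  by move=> hn; rewrite /act_upto ifF //; lia.
case: (a i =P a i.+1) => xy.
  by rewrite subr0 big1 // => b _; rewrite !hq; [rewrite xy eqxx| lia | lia].
congr (_ - _); rewrite (sum_swap (a i) (a i.+1)); apply: eq_bigr => b _.
have -> : act_upto i.-1 (swap (a i) (a i.+1)) a j.+1./2
    = swap (a i) (a i.+1) (a j.+1./2) by rewrite /act_upto ifT //; lia.
rewrite act_upto_conj; [|exact: swap_inj|lia].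
rewrite !hq; try lia.
by rewrite (introF eqP xy).
Qed.

Lemma pa_t_odd_x_low i j : (1 <= i <= k - 1)%N -> (1 <= j <= 2 * i - 1)%N ->
  t (2 * i + 1) * x j = x j * t (2 * i + 1).
Proof.
move=> hi hj; act_norm; rewrite /sum_swaps.
have hq b n : (i <= n)%N -> act_upto j./2 (swap (a j.+1./2) b) a n = a n.
  by move=> hn; rewrite /act_upto ifF //; lia.
case: (a i =P a i.+1) => xy.
  by rewrite subr0 big1 // => b _; rewrite !hq; [rewrite xy eqxx| lia | lia].
congr (_ - _); rewrite (sum_swap (a i) (a i.+1)); apply: eq_bigr => b _.
have -> : act_upto i.+1 (swap (a i) (a i.+1)) a j.+1./2
    = swap (a i) (a i.+1) (a j.+1./2) by rewrite /act_upto ifT //; lia.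
rewrite act_upto_conj; [|exact: swap_inj|lia].
rewrite !hq; try lia.
by rewrite (introF eqP xy).
Qed.

(** Positions i and i+1 are both inside or both outside the prefix of x_j, so the test a_i = a_(i+1)
    is invariant. *)
Lemma pa_e_even_x i j : (1 <= i <= k - 1)%N -> (1 <= j <= 2 * k)%N ->
  j <> (2 * i)%N -> j <> (2 * i + 1)%N -> e (2 * i) * x j = x j * e (2 * i).
Proof.
move=> hi hj ji ji1; act_norm; rewrite /sum_swaps.
have hq b : (act_upto j./2 (swap (a j.+1./2) b) a i
    == act_upto j./2 (swap (a j.+1./2) b) a i.+1) = (a i == a i.+1).
  case: (ltnP j (2 * i)) => hji; rewrite /act_upto.
    by rewrite !ifF //; lia.
  by rewrite !ifT ?(inj_eq (@swap_inj _ _ _)) //; lia.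
under [in RHS]eq_bigr do rewrite hq.
by case: eqP => // _; rewrite subr0 big1.
Qed.

(** If the prefix of x_j contains position i, its transposition also moves the new colour, which a
    change of summation variable absorbs. *)
Lemma pa_e_odd_x i j : (1 <= i <= k)%N -> (1 <= j <= 2 * k)%N ->
  j <> (2 * i - 1)%N -> j <> (2 * i)%N ->
  e (2 * i - 1) * x j = x j * e (2 * i - 1).
Proof.
move=> hi hj ji ji1; act_norm; rewrite /sum_swaps sumrB; congr (_ - _).
rewrite exchange_big; apply: eq_bigr => b _.
have hJ c : recolour a i c j.+1./2 = a j.+1./2.
  by rewrite /recolour ifF //; apply/eqP; lia.
case: (ltnP j (2 * i)) => hji.
  apply: eq_bigr => c _; rewrite hJ; congr f; apply/funext=> n.
  by rewrite /act_upto /recolour; case: (n =P i) => [->|//]; rewrite ifF //; lia.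
rewrite [RHS](sum_swap (a j.+1./2) b); apply: eq_bigr => c _; rewrite hJ.
congr f; apply/funext=> n.
by rewrite /act_upto /recolour; case: (n =P i) => [->|//]; rewrite ifT //; lia.
Qed.

End Relations.

Lemma even_or_odd n : exists i, (n = 2 * i)%N \/ (n = 2 * i + 1)%N.
Proof. by exists n./2; lia. Qed.

Lemma partition_affine_rel (F : numDomainType) (k : nat)
    (u v : partition_algebra F k) : (1 <= k)%N ->
  affine_rel k (pa_t F k) (pa_e F k) (pa_X F k)
    (fun l => pa_z F k * (pa_z F k - 1) ^+ l) u v -> u = v.
Proof.
move=> hk.
(* Relations written with 2i-1 or 2i-2 are shifted by one, to avoid truncated subtraction. *)
have pred_double i : (2 * i.+1 - 2 = 2 * i)%N by lia.
have pred_double1 i : (2 * i.+1 - 1 = 2 * i + 1)%N by lia.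
case=> {u v}; rewrite /tau_range /e_range /x_range.
- exact: pa_t_even_sq.
- exact: pa_t_odd_sq.
- by move=> i j hi hj ij; apply: pa_t_odd_even; lia.
- by move=> i j hi hj ij ji; apply: pa_t_odd_odd; lia.
- by move=> i j hi hj ij ji; apply: pa_t_even_even; lia.
- by move=> i hi; rewrite /aff_s !pa_s_tau; [exact: pa_s_braid | lia | lia].
- by move=> i hi; rewrite mulr1; apply: pa_e_odd_sq.
- exact: pa_e_even_sq.
- exact: pa_t_odd_e.
- exact: pa_e_t_odd.
- exact: pa_t_even_e.
- exact: pa_e_t_even.
- exact: pa_t_ee.
- exact: pa_ee_t.
- move=> i j; have [i' [->|->]] := even_or_odd i;
    have [j' [->|->]] := even_or_odd j => hi hj ij.
  + by apply: pa_e_even_e_even; lia.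
  + by rewrite -pred_double1; apply: pa_e_even_e_odd; lia.
  + by rewrite -pred_double1; apply/esym/pa_e_even_e_odd; lia.
  + by rewrite -!pred_double1; apply: pa_e_odd_e_odd; lia.
- move=> [|i] j hi hj ij ji; first by lia.
  by rewrite pred_double1; apply: pa_t_odd_e_odd; lia.
- move=> [|i] j hi hj ij; first by lia.
  by rewrite pred_double1; apply: pa_t_odd_e_even; lia.
- by move=> i j hi hj ji ij; apply: pa_t_even_e_odd; lia.
- by move=> i j hi hj ij; apply: pa_t_even_e_even; lia.
- move=> i; have [i' [->|->]] := even_or_odd i => hi.
    by apply: pa_eee_up_even; lia.
  have -> : (2 * i' + 1 + 1 = 2 * i'.+1)%N by lia.
  by rewrite -pred_double1; apply: pa_eee_up_odd; lia.
- move=> i; have [i' [->|->]] := even_or_odd i => hi.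
    by apply: pa_eee_down_even; lia.
  have -> : (2 * i' + 1 + 1 = 2 * i'.+1)%N by lia.
  by rewrite -pred_double1; apply: pa_eee_down_odd; lia.
- exact: pa_t_e_odd_t.
- move=> [|i] hi; first by lia.
  by rewrite pred_double pred_double1; apply: pa_t_e_even_t; lia.
- by move=> i j hi hj; apply: pa_x_x.
- move=> i j; have [i' [->|->]] := even_or_odd i => hi hj ij ji1 ji.
    have [hji|hij] := leqP j (2 * i' - 2).
      by apply: pa_t_even_x_low; lia.
    by apply: pa_t_even_x_high; lia.
  have [hji|hij] := leqP j (2 * i' - 1).
    by apply: pa_t_odd_x_low; lia.
  by apply: pa_t_odd_x_high; lia.
- move=> i j; have [i' [->|->]] := even_or_odd i => hi hj ij ji.
    by apply: pa_e_even_x; lia.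
  by rewrite -pred_double1; apply: pa_e_odd_x; lia.
- move=> [|i] hi hi' hi''; first by lia.
  by rewrite pred_double; apply: pa_t_braid_even; lia.
- move=> [|i] hi hi' hi''; first by lia.
  by rewrite pred_double1; apply: pa_t_braid_odd; lia.
- move=> [|i] hi hi' hi''; first by lia.
  by rewrite pred_double pred_double1; apply: pa_t_odd_even_odd; lia.
- move=> [|i] hi hi' hi''; first by lia.
  by rewrite pred_double1; apply: pa_t_even_odd_even; lia.
- by move=> i *; apply: pa_x_odd_next; lia.
- by move=> i *; apply: pa_x_even_next; lia.
- by move=> i *; apply: pa_x_even; lia.
- by move=> i *; apply: pa_x_odd; lia.
- move=> i; have [i' [->|->]] := even_or_odd i => hi.
    by apply: pa_e_even_xx; lia.
  have -> : (2 * i' + 1 + 1 = 2 * i'.+1)%N by lia.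
  by rewrite -pred_double1; apply: pa_e_odd_xx; lia.
- move=> i; have [i' [->|->]] := even_or_odd i => hi.
    by apply: pa_xx_e_even; lia.
  have -> : (2 * i' + 1 + 1 = 2 * i'.+1)%N by lia.
  by rewrite -pred_double1; apply: pa_xx_e_odd; lia.
- by move=> l _ _ _; apply: pa_e_xl_e.
by move=> l u; apply: pa_z_central.
Qed.

(** * Generators of the partition algebra *)

Section DiagramFactorisation.

Variable k : nat.
Local Notation row := {ffun 'I_k -> bool}.
Implicit Types (d : diagram k) (x y z : row) (i j l : 'I_k).

Definition perm_diagram (p : {perm 'I_k}) : diagram k :=
  fibres (fun v => match v with inl i => i | inr i => p i end).

Definition column (v : vertex k) : 'I_k := match v with inl i => i | inr i => i end.

Definition merge_diagram i j : diagram k :=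
  fibres (fun v => if column v == j then i else column v).

(** [None] differs from every block label, so [u] becomes a singleton. *)
Definition detach d (u : vertex k) : diagram k :=
  fibres (fun v => if v == u then None else Some (pblock (val d) v)).

Definition join d (u w : vertex k) : diagram k :=
  fibres (fun v => pblock (val d) (if v == w then u else v)).

Lemma compatible_perm p x y :
  compatible (perm_diagram p) x y = (y == [ffun i => x (p i)]).
Proof.
apply/compatibleP/eqP => [h|->].
  apply/ffunP=> i; rewrite ffunE.
  by have /= -> := h (inr i) (inl (p i)); rewrite // same_block_fibres.
by case=> i [] j; rewrite same_block_fibres /= => /eqP E; rewrite ?ffunE ?E.
Qed.

Lemma compatible_column (T : eqType) (g : 'I_k -> T) x y :
  compatible (fibres (g \o column)) x y
    = (x == y) && [forall i, forall j, (g i == g j) ==> (x i == x j)].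
Proof.
apply/compatibleP/andP => [h|[/eqP<- /forallP h] u v].
  split.
    by apply/eqP/ffunP=> i; apply: (h (inl i) (inr i)); rewrite same_block_fibres.
  apply/forallP=> i; apply/forallP=> j; apply/implyP=> gij.
  by apply/eqP/(h (inl i) (inl j)); rewrite same_block_fibres.
rewrite same_block_fibres /= => guv.
have colE w : colour x x w = x (column w) by case: w.
rewrite !colE; apply/eqP.
by have /forallP/(_ (column v))/implyP := h (column u); apply.
Qed.

Lemma compatible_merge i j x y :
  compatible (merge_diagram i j) x y = (x == y) && (x i == x j).
Proof.
rewrite (compatible_column (fun l => if l == j then i else l)); congr (_ && _).
apply/forallP/eqP => [h|xij l].
  have /forallP/(_ j) := h i; rewrite eqxx; case: ifP => [/eqP <-//|_].
  by rewrite eqxx => /eqP.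
have label l' : x (if l' == j then i else l') = x l' by case: eqP => // ->.
by apply/forallP=> l'; apply/implyP=> /eqP E; rewrite -label E label.
Qed.

Lemma same_block_pblock d u v :
  (pblock (val d) u == pblock (val d) v) = same_block d u v.
Proof.
have /and3P[/eqP cP tP _] := valP d.
by rewrite eq_pblock ?cP ?inE.
Qed.

Lemma same_block_detach d u v w :
  same_block (detach d u) v w = (v == w) || [&& v != u, w != u & same_block d v w].
Proof.
rewrite same_block_fibres; have [->|vu] := eqVneq v u.
  by rewrite [u == w]eq_sym /= orbF; case: (w == u).
have [->|wu] := eqVneq w u; first by rewrite (negbTE vu).
rewrite (inj_eq Some_inj) same_block_pblock /=; case: eqP => // ->.
exact: same_block_refl.
Qed.

Lemma same_block_join d u w v v' : same_block (join d u w) v v' =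
  same_block d (if v == w then u else v) (if v' == w then u else v').
Proof. by rewrite same_block_fibres same_block_pblock. Qed.

(** The equation between the two colours ties [w] back to its block through [u]; a merge diagram
    contributes exactly this equation. *)
Lemma compatible_detach d (u w : vertex k) x y : u != w -> same_block d u w ->
  compatible d x y
    = compatible (detach d w) x y && (colour x y u == colour x y w).
Proof.
move=> uw d_uw; apply/compatibleP/andP => [h|[/compatibleP h /eqP cuw]].
  split; last exact/eqP/h.
  apply/compatibleP=> v v'; rewrite same_block_detach => /orP[/eqP-> //|].
  by case/and3P=> _ _ /h.
have E := partition_same_block d.
have to_w v : same_block d w v -> colour x y w = colour x y v.
  have [->//|vw] := eqVneq v w => wv; rewrite -cuw; apply: h.
  by rewrite same_block_detach uw vw (E u w v).2 ?wv ?orbT.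
move=> v v'; have [->|vw] := eqVneq v w; first exact: to_w.
have [->|v'w] := eqVneq v' w; first by rewrite same_block_sym => /to_w.
by move=> vv'; apply: h; rewrite same_block_detach vw v'w vv' orbT.
Qed.

Definition singleton d v := [forall w, same_block d v w ==> (w == v)].

Lemma singletonP d v :
  reflect (forall w, same_block d v w -> w = v) (singleton d v).
Proof.
apply: (iffP forallP) => [h w vw|h w]; first exact/eqP/(implyP (h w)).
by apply/implyP=> /h ->.
Qed.

Lemma singletonPn d v :
  reflect (exists2 w, same_block d v w & w != v) (~~ singleton d v).
Proof.
rewrite negb_forall; apply: (iffP existsP) => -[w].
  by rewrite negb_imply => /andP[]; exists w.
by move=> vw wv; exists w; rewrite negb_imply vw.
Qed.

Lemma compatible_singleton d i x x' y : singleton d (inl i) ->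
  (forall l, l != i -> x l = x' l) -> compatible d x y -> compatible d x' y.
Proof.
move=> /singletonP si xx' /compatibleP h.
have E v : v != inl i -> colour x y v = colour x' y v.
  by case: v => //= l li; apply: xx'; apply: contraNneq li => ->.
apply/compatibleP=> u v uv; have [ui|ui] := eqVneq u (inl i).
  by move: uv; rewrite ui => /si ->.
have [vi|vi] := eqVneq v (inl i).
  by move: uv; rewrite vi same_block_sym => /si ->.
by rewrite -!E //; apply: h.
Qed.

Lemma compatible_join d (u w : vertex k) x y : singleton d w ->
  compatible (join d u w) x y
    = compatible d x y && (colour x y u == colour x y w).
Proof.
move=> /singletonP sw; apply/compatibleP/andP => [h|[/compatibleP h /eqP cuw]].
  split; last first.
    by apply/eqP/h; rewrite same_block_join eqxx; case: eqP => _; apply: same_block_refl.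
  apply/compatibleP=> v v' vv'; apply: h; rewrite same_block_join.
  have [vw|vw] := eqVneq v w.
    by move: vv'; rewrite vw => /sw ->; rewrite eqxx same_block_refl.
  have [v'w|//] := eqVneq v' w.
  by move: vv' vw; rewrite v'w same_block_sym => /sw ->; rewrite eqxx.
have label v : colour x y (if v == w then u else v) = colour x y v by case: eqP => // ->.
by move=> v v'; rewrite same_block_join => /h; rewrite !label.
Qed.

(** The shift passes from ordinals to positions numbered from 1. *)
Definition cut_diagram i : diagram k := e_odd_diagram k i.+1.

Lemma compatible_cut i x y :
  compatible (cut_diagram i) x y = [forall l, (l != i) ==> (x l == y l)].
Proof.
apply/compatibleP/forallP => [h l|h].
  apply/implyP=> li; apply/eqP/(h (inl l) (inr l)).
  by rewrite same_block_fibres /= eqSS val_eqE (negbTE li).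
have {}h l : l != i -> x l = y l by move=> li; apply/eqP/(implyP (h l)).
have ne l : (l.+1 == k.+1) = false by apply/eqP; have := ltn_ord l; lia.
case=> l [] l'; rewrite same_block_fibres /= !eqSS !val_eqE;
  have [->|li] := eqVneq l i; have [->|l'i] := eqVneq l' i => //;
  rewrite ?ne ?[k.+1 == _]eq_sym ?ne // eqSS val_eqE => /eqP <- //; rewrite h //.
Qed.

End DiagramFactorisation.

(** * A subalgebra containing z, the s_i and the e_i is everything *)

Section Generation.

Variables (F : comNzRingType) (k : nat).
Local Notation PA := (partition_algebra F k).
Variable S : PA -> Prop.
Hypothesis S1 : S 1.
Hypothesis SD : forall u v, S u -> S v -> S (u + v).
Hypothesis SM : forall u v, S u -> S v -> S (u * v).
Hypothesis SZ : forall c u, S u -> S (c *: u).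
Hypothesis Sz : S (pa_z F k).
Hypothesis Ss : forall i, (1 <= i <= k - 1)%N -> S (pa_s F k i).
Hypothesis Se : forall i, (1 <= i <= 2 * k - 1)%N -> S (pa_e F k i).

Local Notation row := {ffun 'I_k -> bool}.
Implicit Types (d a b : diagram k) (x y z : row).
Local Notation D d := (S (pa_diagram F d)).

Lemma generated_ext a d : D a ->
  (forall x y, compatible a x y = compatible d x y) -> D d.
Proof.
move=> Da h; have [|_ <- //] := @compatible_inj k 0 0 a d.
by move=> x y; rewrite h.
Qed.

(** Two-colourings determine both the stacked diagram and the power of 2 counting its loops, so a
    count with coefficient 1 says that the product is [d] without a factor z. *)
Lemma generated_factor a b d : D a -> D b ->
  (forall x z, \sum_y compatible a x y * compatible b y z = compatible d x z)%N ->
  D d.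
Proof.
move=> Da Db h; have [l0 <-] : loops a b = 0%N /\ Defs.comp a b = d.
  apply: compatible_inj => x z.
  by rewrite -(compatible_stack_sum a b x z) h mul1n.
by have := SM Da Db; rewrite pa_diagramM l0 expr0 mul1r.
Qed.

Lemma generated_factor3 a b c d : D a -> D b -> D c ->
  (forall x z, \sum_y \sum_w
      compatible a x y * compatible b y w * compatible c w z
    = compatible d x z)%N ->
  D d.
Proof.
move=> Da Db Dc h.
have [l0 <-] : (loops a b + loops (Defs.comp a b) c = 0)%N
    /\ Defs.comp (Defs.comp a b) c = d.
  apply: compatible_inj => x z; rewrite mul1n -h expnD -mulnA -compatible_stack_sum.
  rewrite exchange_big big_distrr /=; apply: eq_bigr => w _.
  by rewrite -big_distrl /= compatible_stack_sum mulnA.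
have := SM (SM Da Db) Dc; rewrite pa_diagramM -mulrA pa_diagramM mulrA -exprD.
by rewrite l0 mul1r.
Qed.

Lemma generated_permM (p q : {perm 'I_k}) :
  D (perm_diagram p) -> D (perm_diagram q) -> D (perm_diagram (p * q)%g).
Proof.
(* In [p * q] the permutation [p] acts first, while stacking [q] above [p] turns x into x o q o p;
   hence the reversed order. *)
move=> Dp Dq; apply: (generated_factor Dq Dp) => x z.
rewrite (bigD1 [ffun i => x (q i)]) //= [X in (_ + X)%N]big1; last first.
  by move=> y /negbTE ne; rewrite compatible_perm ne.
rewrite !compatible_perm eqxx mul1n addn0; congr (nat_of_bool (z == _)).
by apply/ffunP=> i; rewrite !ffunE permM.
Qed.

Lemma generated_perm (p : {perm 'I_k}) : D (perm_diagram p).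
Proof.
have adjacent (i j : 'I_k) : j = i.+1 :> nat -> D (perm_diagram (tperm i j)).
  move=> ji; have jk := ltn_ord j.
  suff -> : perm_diagram (tperm i j) = s_diagram k j by apply: Ss; lia.
  apply: same_block_inj => u v; rewrite !same_block_fibres.
  have label (l : 'I_k) : (tperm i j l).+1
      = if l.+1 == j then j.+1 else if l.+1 == j.+1 then val j else l.+1.
    case: tpermP => [->|->|li lj].
    - by rewrite ji !eqxx.
    - by rewrite ifF ?eqxx ?ji //; lia.
    - have {}li : l <> i :> nat by move/val_inj.
      have {}lj : l <> j :> nat by move/val_inj.
      by rewrite !ifF //; lia.
  by case: u v => u [] v; rewrite -?label -val_eqE.
have all_tperm n (i j : 'I_k) : (j < i + n)%N -> (i < j)%N ->
    D (perm_diagram (tperm i j)).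
  elim: n j => [|n IH] j hj ij; first by lia.
  have [/adjacent//|ne] := eqVneq (j : nat) i.+1.
  have lt : (j.-1 < k)%N by have := ltn_ord j; lia.
  pose j' := Ordinal lt.
  (* Conjugating (i j') by the adjacent transposition (j' j) shortens the distance by one. *)
  have -> : tperm i j = (tperm j' j * (tperm i j' * tperm j' j))%g.
    have := tpermJ i j' (tperm j' j); rewrite tpermL tpermD.
    - by rewrite conjgE tpermV => <-.
    - by rewrite -val_eqE /=; lia.
    - by rewrite -val_eqE /=; lia.
  have Dj : D (perm_diagram (tperm j' j)) by apply: adjacent => /=; lia.
  by do ![apply: generated_permM => //]; apply: IH => /=; lia.
have [ts -> _] := prod_tpermP p.
elim: ts => [|[i j] ts IH].
  rewrite big_nil; apply: (generated_ext S1) => x y.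
  rewrite compatible_id compatible_perm eq_sym; congr (y == _).
  by apply/ffunP=> i; rewrite ffunE perm1.
rewrite big_cons; apply: generated_permM => //=.
have [ij|ji|/val_inj->] := ltngtP i j.
- by apply: (all_tperm k) => //; have := ltn_ord j; lia.
- by rewrite tpermC; apply: (all_tperm k) => //; have := ltn_ord i; lia.
rewrite tperm1; apply: (generated_ext S1) => x y.
rewrite compatible_id compatible_perm eq_sym; congr (y == _).
by apply/ffunP=> l; rewrite ffunE perm1.
Qed.

Lemma generated_merge (i j : 'I_k) : i != j -> D (merge_diagram i j).
Proof.
move=> ij; have k_gt1 : (1 < k)%N.
  by move: ij; rewrite -val_eqE /=; have := ltn_ord i; have := ltn_ord j; lia.
pose a : 'I_k := Ordinal (ltnW k_gt1); pose b : 'I_k := Ordinal k_gt1.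
have Dab : D (merge_diagram a b).
  suff -> : merge_diagram a b = e_even_diagram k 1.
    by apply: (Se _ : S (pa_e F k 2)); lia.
  apply: same_block_inj => u v; rewrite !same_block_fibres.
  have label w : (if @position k w == 2 then 1%N else position w)
      = (if @column k w == b then a else column w).+1.
    have lab (l : 'I_k) :
        (if l.+1 == 2 then 1%N else l.+1) = (if l == b then a else l).+1.
      by rewrite -[l == b]val_eqE /= eqSS; case: ifP.
    by case: w => l; apply: lab.
  by rewrite !label.
(* The first factor sends [a] to [i], the second sends the image of [b] to [j] and fixes [i];
   conjugating by [p] carries e_2 to the merge of columns [i] and [j]. *)
pose p := (tperm a i * tperm (tperm a i b) j)%g.
have pa : p a = i.
  rewrite permM tpermL tpermD 1?eq_sym //.
  by rewrite -{1}(tpermL a i) (inj_eq perm_inj).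
have pb : p b = j by rewrite permM tpermL.
apply: (generated_factor3 (generated_perm p) Dab (generated_perm p^-1)) => x z.
pose y := [ffun l => x (p l)].
have xE : [ffun l => y ((p^-1)%g l)] = x.
  by apply/ffunP=> l; rewrite !ffunE permKV.
rewrite (bigD1 y) //= [X in (_ + X)%N]big1 ?addn0 => [|y' /negbTE ne]; last first.
  by apply: big1 => w _; rewrite compatible_perm ne.
rewrite (bigD1 y) //= [X in (_ + X)%N]big1 ?addn0 => [|w ne]; last first.
  by rewrite compatible_merge eq_sym (negbTE ne) muln0.
rewrite !compatible_perm !compatible_merge !eqxx xE mul1n mulnb andbC.
by rewrite [z == x]eq_sym !ffunE pa pb.
Qed.

Lemma generated_detach_top d (i j : 'I_k) : i != j ->
  same_block d (inl i) (inl j) -> D (detach d (inl j)) -> D d.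
Proof.
move=> ij dij Dd; apply: (generated_factor (generated_merge ij) Dd) => x z.
rewrite (bigD1 x) //= [X in (_ + X)%N]big1 ?addn0 => [|y ne]; last first.
  by rewrite compatible_merge eq_sym (negbTE ne).
rewrite compatible_merge eqxx (compatible_detach x z _ dij).
  by rewrite mulnb andbC.
by apply: contraNneq ij => -[->].
Qed.

Lemma generated_detach_bottom d (i j : 'I_k) : i != j ->
  same_block d (inr i) (inr j) -> D (detach d (inr j)) -> D d.
Proof.
move=> ij dij Dd; apply: (generated_factor Dd (generated_merge ij)) => x z.
rewrite (bigD1 z) //= [X in (_ + X)%N]big1 ?addn0 => [|y ne]; last first.
  by rewrite compatible_merge (negbTE ne) muln0.
rewrite compatible_merge eqxx (compatible_detach x z _ dij).
  by rewrite mulnb.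
by apply: contraNneq ij => -[->].
Qed.

Lemma generated_cut (i : 'I_k) : D (cut_diagram i).
Proof.
have -> : pa_diagram F (cut_diagram i) = pa_e F k (2 * i + 1).
  rewrite /pa_e /cut_diagram; have -> : odd (2 * i + 1) by lia.
  by have -> : (2 * i + 1).+1./2 = i.+1 by lia.
by apply: Se; have := ltn_ord i; lia.
Qed.

(** Cutting column i above the joined diagram separates the two vertices again. No loop arises,
    since the middle vertex i stays attached to the bottom vertex j: [y0] is the only middle row. *)
Lemma generated_join d (i j : 'I_k) : singleton d (inl i) -> singleton d (inr j) ->
  D (join d (inl i) (inr j)) -> D d.
Proof.
move=> si sj Dj; apply: (generated_factor (generated_cut i) Dj) => x z.
pose y0 := [ffun l => if l == i then z j else x l].
rewrite (bigD1 y0) //= [X in (_ + X)%N]big1 ?addn0 => [|y ne].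
  rewrite compatible_cut compatible_join //= ffunE !eqxx andbT.
  have -> : [forall l, (l != i) ==> (x l == y0 l)].
    by apply/forallP=> l; apply/implyP=> li; rewrite ffunE (negbTE li).
  rewrite mul1n; congr nat_of_bool.
  by apply/idP/idP; apply: (compatible_singleton si) => l li; rewrite ffunE (negbTE li).
rewrite compatible_cut compatible_join //= mulnb; apply/eqP; rewrite eqb0.
apply: contra ne => /andP[/forallP h /andP[_ /eqP yz]].
apply/eqP/ffunP=> l; rewrite ffunE; case: eqP => [->//|/eqP li].
by apply/esym/eqP/(implyP (h l)).
Qed.


(** These are the partial permutations, the elements of the rook monoid. *)
Definition rook d := [forall i, forall j, (i != j) ==>
  ~~ same_block d (inl i) (inl j) && ~~ same_block d (inr i) (inr j)].

Lemma rookP d : reflect ((forall i j, same_block d (inl i) (inl j) -> i = j)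
    /\ (forall i j, same_block d (inr i) (inr j) -> i = j)) (rook d).
Proof.
apply: (iffP forallP) => [h|[h1 h2] i].
  by split=> i j; apply: contraTeq => ij;
    have /forallP/(_ j)/implyP/(_ ij)/andP[h1 h2] := h i.
apply/forallP=> j; apply/implyP=> /eqP ij.
by apply/andP; split; apply/negP; [move/h1|move/h2].
Qed.

Definition block_pairs d := [set p | same_block d p.1 p.2].

Lemma generated_rook_no_singleton d : rook d ->
  (forall j, ~~ singleton d (inr j)) -> D d.
Proof.
move=> /rookP[rt rb] ns.
have /choice[p dp] : forall j, exists i, same_block d (inr j) (inl i).
  move=> j.
  have /singletonPn[[i|j'] ij ne] := ns j; first by exists i.
  by case/eqP: ne; rewrite (rb _ _ ij).
have E := partition_same_block d.
have p_inj : injective p.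
  move=> j j' pj; apply: rb; rewrite (E _ (inl (p j)) _).2; last exact: (dp j).
  by rewrite pj same_block_sym.
rewrite (_ : d = perm_diagram (perm p_inj)); first exact: generated_perm.
apply: same_block_inj => u v; rewrite same_block_fibres.
pose lab (w : vertex k) := match w with inl i => i | inr j => perm p_inj j end.
have labE w : same_block d w (inl (lab w)).
  by case: w => [i|j] /=; rewrite ?permE; [apply: same_block_refl|].
rewrite -[RHS]/(lab u == lab v) (E _ (inl (lab u)) _).2; last exact: (labE u).
rewrite same_block_sym (E _ (inl (lab v)) _).2; last exact: (labE v).
apply/idP/eqP => [/rt->//|->]; exact: same_block_refl.
Qed.

(** A singleton at the bottom forces one at the top; joining them completes the partial permutation
    by one pair, until no bottom singleton is left. *)
Lemma generated_rook d : rook d -> D d.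
Proof.
have [n] := ubnP (#|{: vertex k * vertex k}| - #|block_pairs d|).
elim: n d => // n IH d dn rd.
have [/existsP[j sj]|/existsPn] := boolP [exists j, singleton d (inr j)]; last first.
  exact: generated_rook_no_singleton.
have /rookP[rt rb] := rd.
(* Otherwise the top row would be matched injectively, hence bijectively, with the bottom row,
   including the singleton [j]. *)
have [i si] : exists i, singleton d (inl i).
  apply/existsP; apply: contraT => /existsPn ns.
  have /choice[g dg] : forall i, exists j, same_block d (inl i) (inr j).
    move=> i.
    have /singletonPn[[i'|j'] ij ne] := ns i; last by exists j'.
    by case/eqP: ne; rewrite (rt _ _ ij).
  have g_inj : injective g.
    move=> i i' gi; apply: rt.
    rewrite (partition_same_block d _ (inr (g i)) _).2; last exact: (dg i).
    by rewrite gi same_block_sym.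
  have := dg (invF g_inj j); rewrite f_invF same_block_sym.
  by move/singletonP: sj => sj /sj.
have /singletonP si' := si; have /singletonP sj' := sj.
apply: (generated_join si sj); apply: IH.
  have lt : (#|block_pairs d| < #|block_pairs (join d (inl i) (inr j))|)%N.
    apply/proper_card/properP; split.
      apply/subsetP=> -[v w]; rewrite !inE /= same_block_join.
      have [->|vj] := eqVneq v (inr j).
        by move/sj' ->; rewrite eqxx same_block_refl.
      have [->|//] := eqVneq w (inr j); rewrite same_block_sym => /sj' vj'.
      by rewrite vj' eqxx in vj.
    exists (inl i, inr j); rewrite !inE /= ?same_block_join ?eqxx ?same_block_refl //.
    by apply/negP=> /si'.
  rewrite ltnS in dn; apply: leq_trans dn; apply: ltn_sub2l => //.
  by apply: leq_trans lt _; apply: max_card.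
apply/rookP; split=> a b; rewrite same_block_join /=; first exact: rt.
have inr_eq (l : 'I_k) : (inr l == inr j :> vertex k) = (l == j) by [].
rewrite !inr_eq; case: (a =P j) => [->|_]; case: (b =P j) => [->|_] //.
- by move/si'.
- by rewrite same_block_sym => /si'.
exact: rb.
Qed.

(** Outside the rook monoid two vertices of one row share a block; a merge splits off, and detaching
    one of them leaves fewer related pairs. *)
Lemma generated_diagram d : D d.
Proof.
have [n] := ubnP #|block_pairs d|; elim: n d => // n IH d dn.
have [/generated_rook//|] := boolP (rook d).
have IHd (u w : vertex k) : u != w -> same_block d u w -> D (detach d w).
  move=> uw d_uw; apply: IH; rewrite ltnS in dn; apply: leq_trans dn.
  apply/proper_card/properP; split.
    apply/subsetP=> -[v v']; rewrite !inE /= same_block_detach.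
    by case/orP=> [/eqP->|/and3P[]//]; apply: same_block_refl.
  by exists (u, w); rewrite !inE //= same_block_detach (negbTE uw) eqxx andbF.
case/forallPn=> i /forallPn[j].
rewrite negb_imply negb_and !negbK => /andP[ij /orP[] dij].
  apply: (generated_detach_top ij dij); apply: IHd dij.
  by apply: contraNneq ij => -[->].
apply: (generated_detach_bottom ij dij); apply: IHd dij.
by apply: contraNneq ij => -[->].
Qed.

Theorem pa_generated u : S u.
Proof.
have S0 : S 0 by rewrite -(scale0r 1); apply: SZ.
have Ssum (J : finType) (G : J -> PA) : (forall i, S (G i)) -> S (\sum_i G i).
  by move=> SG; apply: big_ind.
have SX n : S (pa_z F k ^+ n).
  by elim: n => [|n IH]; rewrite ?expr0 // exprS; apply: SM.
(* [S] is closed under scalars of [F] only, so the coefficients are expanded in powers of z. *)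
rewrite (_ : u = \sum_d \sum_(n < size (u d))
                   (u d)`_n *: (pa_z F k ^+ n * pa_diagram F d)).
  apply: (Ssum) => d; apply: (Ssum) => n; apply: SZ; apply: SM => //.
  exact: generated_diagram.
apply/ffunP=> d; rewrite sum_ffunE (bigD1 d) //= [X in _ + X]big1 ?addr0.
  rewrite sum_ffunE -{1}[u d]coefK poly_def; apply: eq_bigr => n _.
  by rewrite ffunE pa_zXM pa_diagramE eqxx mulr1.
move=> d' ne; rewrite sum_ffunE big1 // => n _.
by rewrite ffunE pa_zXM pa_diagramE eq_sym (negbTE ne) mulr0 scaler0.
Qed.

End Generation.

Theorem lemma3p1p2 (R : realType) (k : nat) (hk : (1 <= k)%N) :
  exists pr : {lrmorphism affine_partition_algebra R[i] k
                 -> partition_algebra R[i] k},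
    [/\ forall i, (2 <= i <= 2 * k - 1)%N -> pr (aff_tau R[i] k i) = pa_t R[i] k i,
        forall i, (1 <= i <= 2 * k - 1)%N -> pr (aff_e R[i] k i) = pa_e R[i] k i,
        forall i, (1 <= i <= 2 * k)%N -> pr (aff_x R[i] k i) = pa_X R[i] k i,
        forall l, pr (aff_z R[i] k l) = pa_z R[i] k * (pa_z R[i] k - 1) ^+ l
      & forall a, exists b, pr b = a].
Proof.
have [pr [prt pre prx prz]] := @affine_algebra_universal R[i] k
  (partition_algebra R[i] k) _ _ _ _ (fun u v => @partition_affine_rel R[i] k u v hk).
exists pr; split=> //.
apply: pa_generated => [|u v [b <-] [c <-]|u v [b <-] [c <-]|c u [b <-]||i hi|i hi].
- by exists 1; rewrite rmorph1.
- by exists (b + c); rewrite rmorphD.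
- by exists (b * c); rewrite rmorphM.
- by exists (c *: b); rewrite linearZ.
- by exists (aff_z _ k 0); rewrite prz mulr1.
(* s_i is not a generator of the affine algebra; it is recovered from its expression in tau and
   e. *)
- exists (aff_tau _ k (2 * i) * aff_tau _ k (2 * i + 1) + aff_e _ k (2 * i)).
  rewrite rmorphD rmorphM /= !prt ?pre ?pa_s_tau //; rewrite /tau_range /e_range; lia.
- by exists (aff_e _ k i); rewrite pre.
Qed.
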